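(* Let $\mathcal O$ be a complete discrete valuation ring with field of fractions $K$ and finite residue field $\kappa$ of cardinality $q$, and let $\mathcal O'$ be the ring of integers of a finite extension $K'$ of $K$, with fixed uniformizer $\varpi$. Let $\mathcal O'/\mathcal O$ be a totally ramified extension of degree $e$. Then the morphism of $\kappa$-ring schemes $$\boldsymbol u^{\mathrm{ra}}_{\kappa}\colon \prod^{\varpi}\mathbb W_{\mathcal O,\kappa}\to\mathbb W_{\mathcal O',\kappa}$$ is a universal homeomorphism with pro-infinitesimal kernel isomorphic to $$\mathrm{Spec}\big(\kappa[X_{n,i};\, n\in\mathbb N_0,\,0\le i<e]/(X_{n,i}^{q^{n(e-1)+i}};\, n\in\mathbb N_0,\,0\le i<e)\big).$$
   Context: **Ramified Witt vectors.** Let $\mathcal O$ be a complete discrete valuation ring with finite residue field $\kappa$ of cardinality $q$ and fixed uniformizer $\pi$. For an $\mathcal O$-algebra $B$, $W_{\mathcal O}(B)$ is the set $B^{\mathbb N_0}$ endowed with the unique $\mathcal O$-algebra structure, functorial in $B$, such that for every $B$ the map $\Phi_B\colon W_{\mathcal O}(B)\to B^{\mathbb N_0}$, $\boldsymbol b=(b_n)_n\mapsto(\Phi_n(\boldsymbol b))_n$, with $\Phi_n(\boldsymbol b)=b_0^{q^n}+\pi b_1^{q^{n-1}}+\dots+\pi^n b_n$, is a homomorphism of $\mathcal O$-algebras ($B^{\mathbb N_0}$ on the right is the product ring, with $\mathcal O$ acting componentwise). $\mathbb W_{\mathcal O}=\mathrm{Spec}\,\mathcal O[X_0,X_1,\dots]$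 is the ring scheme over $\mathcal O$ representing $B\mapsto W_{\mathcal O}(B)$. The subscript $\kappa$ denotes special fibers. **Drinfeld's morphism.** Let $\mathcal O'$ be the ring of integers of a finite extension of $K$ with uniformizer $\varpi$ and residue field of cardinality $q^r$ (here $r=1$, as the extension is totally ramified); let $\Phi'_n$ be the analogous polynomials for $\mathcal O'$ (with $\varpi,q^r$ in place of $\pi,q$). There is a unique morphism of $\mathcal O'$-ring schemes $\boldsymbol u\colon \mathbb W_{\mathcal O}\times_{\mathcal O}\mathrm{Spec}(\mathcal O')\to\mathbb W_{\mathcal O'}$ such that $\Phi'_n(u_B(\boldsymbol b))=\Phi_{nr}(\boldsymbol b)$ for all $n\ge 0$, all $\mathcal O'$-algebras $B$ and all $\boldsymbol b\in W_{\mathcal O}(B)$, where $u_B\colon W_{\mathcal O}(B)\to W_{\mathcal O'}(B)$ is the induced map; $u_B$ is a homomorphism of $\mathcal O$-algebras. **The morphism $\boldsymbol u^{\mathrm{ra}}$.** For $\mathcal O'/\mathcal O$ totally ramified of degree $e$ the residue fields coincide and $\mathcal O'=\oplus_{i=0}^{e-1}\mathcal O\varpi^i$. Let $\prod^{\varpi}\mathbb W_{\mathcal O}$ be the ring scheme over $\mathcal O$ representing $A\mapsto W_{\mathcal O}(A)\otimes_{\mathcal O}\mathcal O'=\oplus_{i=0}^{e-1}W_{\mathcal O}(A)\varpi^i$; as a group scheme it is $\prod_{i=0}^{e-1}\mathbb W_{\mathcal O}$. Then $\boldsymbol u^{\mathrm{ra}}\colon \prod^{\varpi}\mathbb W_{\mathcal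 O}\times_{\mathcal O}\mathrm{Spec}(\mathcal O')\to\mathbb W_{\mathcal O'}$ is the morphism of ring schemes given on $B$-sections, for $\mathcal O'$-algebras $B$, by $u^{\mathrm{ra}}_B\colon\sum_i\boldsymbol b_i\otimes\varpi^i\mapsto\sum_i u_B(\boldsymbol b_i)\varpi^i$, and $\boldsymbol u^{\mathrm{ra}}_\kappa$ is its restriction to special fibers. A pro-infinitesimal group scheme over a field is an affine group scheme that is an inverse limit of infinitesimal ones (finite group schemes whose underlying space is one point). The isomorphism describing the kernel is an isomorphism of $\kappa$-schemes. *)

(* Defs.v *)
From HB Require Import structures.
From mathcomp Require Import all_boot all_order all_algebra all_field.
From mathcomp Require Import generic_quotient.
From mathcomp Require Import boolp classical_sets topology.
From mathcomp Require Import monalg.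

Set Implicit Arguments.
Unset Strict Implicit.
Unset Printing Implicit Defensive.

Import GRing.Theory.
Local Open Scope ring_scope.

(* An algebra is a ring with a structure morphism, rather than a [comAlgType]:
   this makes restriction of scalars available without declaring instances,
   and it does not exclude the zero ring. *)
Record algebra (R : comPzRingType) := Algebra {
  alg_ring :> comPzRingType;
  alg_map : {rmorphism R -> alg_ring} }.

Record alg_hom (R : comPzRingType) (A B : algebra R) := AlgHom {
  alg_fun :> {rmorphism A -> B};
  alg_funE : forall r, alg_fun (alg_map A r) = alg_map B r }.

Lemma rmorph_ext (A B : comPzRingType) (f g : {rmorphism A -> B}) :
  f =1 g -> f = g.
Proof.
case: f => f [[f1] [f2]]; case: g => g [[g1] [g2]] /= /funext E.
case: _ / E in g1 g2 *.
by rewrite (Prop_irrelevance f1 g1) (Prop_irrelevance f2 g2).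
Qed.

Lemma alg_hom_ext (R : comPzRingType) (A B : algebra R) (f g : alg_hom A B) :
  f =1 g -> f = g.
Proof.
case: f g => [f f1] [g g1] /= /rmorph_ext E.
by case: _ / E in g1 *; congr AlgHom; exact: Prop_irrelevance.
Qed.

Definition alg_id (R : comPzRingType) (A : algebra R) : alg_hom A A :=
  @AlgHom R A A idfun (fun r => erefl).

Section AlgComp.
Variables (R : comPzRingType) (A B C : algebra R).
Variables (g : alg_hom B C) (f : alg_hom A B).

Lemma alg_compE r : (g \o f) (alg_map A r) = alg_map C r.
Proof. by rewrite /= !alg_funE. Qed.

Definition alg_comp : alg_hom A C := AlgHom alg_compE.
End AlgComp.

Section Restriction.
Variables (R S : comPzRingType) (phi : {rmorphism R -> S}).

Definition restr (B : algebra S) : algebra R := Algebra (alg_map B \o phi).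

Definition restr_hom (A B : algebra S) (f : alg_hom A B) :
    alg_hom (restr A) (restr B) :=
  @AlgHom R (restr A) (restr B) (alg_fun f) (fun r => alg_funE f (phi r)).
End Restriction.

Definition is_ideal (A : comPzRingType) (I : set A) : Prop :=
  [/\ I 0, forall x y, I x -> I y -> I (x + y) & forall a x, I x -> I (a * x)].

Definition ideal_gen (A : comPzRingType) (E : set A) : set A :=
  fun x => exists n (a g : 'I_n -> A),
    (forall i, E (g i)) /\ x = \sum_(i < n) a i * g i.

Lemma ideal_gen_is_ideal (A : comPzRingType) (E : set A) :
  is_ideal (ideal_gen E).
Proof.
split.
- by exists 0, (fun=> 0), (fun=> 0); split=> [[]|]; rewrite ?big_ord0.
- move=> _ _ [n [a [g [Eg ->]]]] [m [b [h [Eh ->]]]].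
  exists (n + m)%N, (fun i => match split i with inl j => a j | inr j => b j end),
    (fun i => match split i with inl j => g j | inr j => h j end); split.
    by move=> i; case: (split i).
  rewrite big_split_ord /=; congr (_ + _); apply: eq_bigr => i _.
    by rewrite (unsplitK (inl _ i)).
  by rewrite (unsplitK (inr _ i)).
- move=> c _ [n [a [g [Eg ->]]]]; exists n, (fun i => c * a i), g; split=> //.
  by rewrite mulr_sumr; apply: eq_bigr => i _; rewrite mulrA.
Qed.

(* [ring_quotient] only provides quotients of non-trivial rings by proper
   ideals. *)
Section Quotient.
Variables (A : comPzRingType) (E : set A).
Let I := ideal_gen E.

Definition quot_rel (x y : A) : bool := `[< I (x - y) >].

Lemma quot_rel_equiv : equiv_class_of quot_rel.
Proof.
have [I0 ID IM] := ideal_gen_is_ideal E.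
have IN x : I x -> I (- x) by move=> /(IM (- 1)); rewrite mulN1r.
split=> [x|x y|y x z].
- by apply/asboolP; rewrite subrr.
- by apply/asboolP/asboolP => /IN; rewrite opprB.
- move=> /asboolP Ixy /asboolP Iyz; apply/asboolP.
  by rewrite -(subrK y x) -addrA; exact: ID.
Qed.

Canonical quot_equiv := EquivRelPack quot_rel_equiv.

Definition quot : Type := {eq_quot quot_rel}%qT.
HB.instance Definition _ : EqQuotient A quot_rel quot := EqQuotient.on quot.
HB.instance Definition _ := Choice.on quot.

Local Notation pi := (\pi_quot)%qT.

Lemma quot_eqP x y : pi x = pi y <-> I (x - y).
Proof.
split=> [/eqP|Ixy]; first by rewrite eqmodE => /asboolP.
by apply/eqP; rewrite eqmodE; apply/asboolP.
Qed.

Let reprP x : I (repr (pi x) - x).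
Proof. by apply/quot_eqP; rewrite reprK. Qed.

Definition quot_add (u v : quot) : quot := pi (repr u + repr v).
Definition quot_opp (u : quot) : quot := pi (- repr u).
Definition quot_mul (u v : quot) : quot := pi (repr u * repr v).

Lemma quot_addE x y : quot_add (pi x) (pi y) = pi (x + y).
Proof.
have [I0 ID IM] := ideal_gen_is_ideal E.
by apply/quot_eqP; rewrite opprD addrACA; apply: ID; exact: reprP.
Qed.

Lemma quot_oppE x : quot_opp (pi x) = pi (- x).
Proof.
have [I0 ID IM] := ideal_gen_is_ideal E; apply/quot_eqP.
by rewrite -opprD -mulN1r; apply: IM; exact: reprP.
Qed.

Lemma quot_mulE x y : quot_mul (pi x) (pi y) = pi (x * y).
Proof.
have [I0 ID IM] := ideal_gen_is_ideal E; apply/quot_eqP.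
have -> : repr (pi x) * repr (pi y) - x * y =
    repr (pi x) * (repr (pi y) - y) + y * (repr (pi x) - x).
  by rewrite !mulrBr addrA [y * repr _]mulrC subrK [y * x]mulrC.
by apply: ID; apply: IM; exact: reprP.
Qed.

Let quotW (P : quot -> Prop) : (forall x, P (pi x)) -> forall u, P u.
Proof. by move=> H u; rewrite -[u]reprK; exact: H. Qed.

Lemma quot_addA : associative quot_add.
Proof.
by elim/quotW=> x; elim/quotW=> y; elim/quotW=> z; rewrite !quot_addE addrA.
Qed.

Lemma quot_addC : commutative quot_add.
Proof. by elim/quotW=> x; elim/quotW=> y; rewrite !quot_addE addrC. Qed.

Lemma quot_add0 : left_id (pi 0) quot_add.
Proof. by elim/quotW=> x; rewrite !quot_addE add0r. Qed.

Lemma quot_addN : left_inverse (pi 0) quot_opp quot_add.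
Proof. by elim/quotW=> x; rewrite quot_oppE !quot_addE addNr. Qed.

HB.instance Definition _ :=
  GRing.isZmodule.Build quot quot_addA quot_addC quot_add0 quot_addN.

Lemma quot_mulA : associative quot_mul.
Proof. by elim/quotW=> x; elim/quotW=> y; elim/quotW=> z; rewrite !quot_mulE mulrA. Qed.

Lemma quot_mulC : commutative quot_mul.
Proof. by elim/quotW=> x; elim/quotW=> y; rewrite !quot_mulE mulrC. Qed.

Lemma quot_mul1 : left_id (pi 1) quot_mul.
Proof. by elim/quotW=> x; rewrite !quot_mulE mul1r. Qed.

Lemma quot_mulDl : left_distributive quot_mul quot_add.
Proof.
elim/quotW=> x; elim/quotW=> y; elim/quotW=> z.
by rewrite !(quot_mulE, quot_addE) mulrDl.
Qed.

HB.instance Definition _ := GRing.Zmodule_isComPzRing.Build quot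
  quot_mulA quot_mulC quot_mul1 quot_mulDl.

Definition quot_proj (x : A) : quot := pi x.

Lemma quot_proj_zmod : zmod_morphism quot_proj.
Proof. by move=> x y; rewrite /quot_proj -quot_addE -quot_oppE. Qed.

Lemma quot_proj_monoid : monoid_morphism quot_proj.
Proof. by split=> // x y; rewrite /quot_proj -quot_mulE. Qed.

HB.instance Definition _ :=
  GRing.isZmodMorphism.Build A quot quot_proj quot_proj_zmod.
HB.instance Definition _ :=
  GRing.isMonoidMorphism.Build A quot quot_proj quot_proj_monoid.
End Quotient.

Record tensor (R A B : comPzRingType)
    (f : {rmorphism R -> A}) (g : {rmorphism R -> B}) := Tensor {
  tens_ring :> comPzRingType;
  tens_l : {rmorphism A -> tens_ring};
  tens_r : {rmorphism B -> tens_ring};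
  tens_comm : forall r, tens_l (f r) = tens_r (g r);
  tens_copair : forall (C : comPzRingType)
    (h : {rmorphism A -> C}) (k : {rmorphism B -> C}),
    (forall r, h (f r) = k (g r)) -> {rmorphism tens_ring -> C};
  tens_copair_l : forall (C : comPzRingType)
    (h : {rmorphism A -> C}) (k : {rmorphism B -> C})
    (e : forall r, h (f r) = k (g r)) a, tens_copair e (tens_l a) = h a;
  tens_copair_r : forall (C : comPzRingType)
    (h : {rmorphism A -> C}) (k : {rmorphism B -> C})
    (e : forall r, h (f r) = k (g r)) b, tens_copair e (tens_r b) = k b;
  tens_ext : forall (C : comPzRingType) (h k : {rmorphism tens_ring -> C}),
    (forall a, h (tens_l a) = k (tens_l a)) ->
    (forall b, h (tens_r b) = k (tens_r b)) -> h =1 k }.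

Definition prime_ideal (A : comPzRingType) (P : set A) : Prop :=
  [/\ is_ideal P, ~ P 1 & forall x y, P (x * y) -> P x \/ P y].

Record spec (A : comPzRingType) :=
  Spec { spec_ideal : set A; spec_prime : prime_ideal spec_ideal }.

HB.instance Definition _ (A : comPzRingType) := gen_eqMixin (spec A).
HB.instance Definition _ (A : comPzRingType) := gen_choiceMixin (spec A).

Section Zariski.
Local Open Scope classical_set_scope.
Variable A : comPzRingType.

Definition zariski_open (U : set (spec A)) : Prop :=
  exists E : set A, U = [set p | ~ E `<=` spec_ideal p].

Lemma zariski_openT : zariski_open setT.
Proof.
exists setT; apply/seteqP; split=> // -[P [PI P1 PM]] _ /= H.
exact: P1 (H 1 Logic.I).
Qed.

Lemma zariski_openI : setI_closed zariski_open.
Proof.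
move=> _ _ [E ->] [F ->].
exists [set z | exists x y, [/\ E x, F y & z = x * y]].
apply/seteqP; split=> -[P [PI P1 PM]] /=.
- move=> [/existsNP[x /not_implyP[Ex NPx]] /existsNP[y /not_implyP[Fy NPy]]] H.
  by have /PM[] // : P (x * y) by apply: H; exists x, y.
- have [_ _ PMl] := PI.
  move=> H; split=> EP; apply: H => _ [x [y [Ex Fy ->]]].
    by rewrite mulrC; apply: PMl; exact: EP.
  by apply: PMl; exact: EP.
Qed.

Lemma zariski_open_bigU (I : Type) (f : I -> set (spec A)) :
  (forall i, zariski_open (f i)) -> zariski_open (\bigcup_i f i).
Proof.
move=> /choice[E fE]; exists (\bigcup_i E i).
apply/seteqP; split=> [p [i _]|p /= H].
  by rewrite fE /= => NEp H; apply: NEp => x Ex; apply: H; exists i.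
apply: contrapT => NU; apply: H => x [i _ Eix].
apply: contrapT => Npx; apply: NU; exists i => //.
by rewrite fE /= => /(_ _ Eix).
Qed.

HB.instance Definition _ := isOpenTopological.Build (spec A)
  zariski_openT zariski_openI zariski_open_bigU.
End Zariski.

Section SpecMap.
Variables (A B : comPzRingType) (phi : {rmorphism A -> B}).

Lemma spec_map_prime (p : spec B) : prime_ideal (fun a => spec_ideal p (phi a)).
Proof.
case: p => P [[P0 PD PM] P1 PP]; split=> [||x y] /=; last by rewrite rmorphM; exact: PP.
- by split=> [|x y|a x]; rewrite ?(rmorph0, rmorphD, rmorphM); auto.
- by rewrite rmorph1.
Qed.

Definition spec_map (p : spec B) : spec A := Spec (spec_map_prime p).
End SpecMap.

Definition homeomorphism (X Y : topologicalType) (f : X -> Y) : Prop :=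
  exists g : Y -> X,
    [/\ cancel f g, cancel g f, continuous f & continuous g].

(* [Spec B -> Spec A] is a universal homeomorphism: every base change along
   [Spec C -> Spec A] is a homeomorphism.  Being a homeomorphism is local on
   the target, so that affine base changes suffice. *)
Definition universal_homeomorphism_ring (A B : comPzRingType)
    (phi : {rmorphism A -> B}) : Prop :=
  forall (C : comPzRingType) (g : {rmorphism A -> C}) (D : tensor phi g),
    homeomorphism (spec_map (tens_r D)).

(* Affine schemes over [R] are identified with representable functors on
   [R]-algebras. *)
Record set_functor (R : comPzRingType) := SetFunctor {
  sf_obj :> algebra R -> Type;
  sf_map : forall A B, alg_hom A B -> sf_obj A -> sf_obj B;
  sf_map_id : forall A (x : sf_obj A), sf_map (alg_id A) x = x;
  sf_map_comp : forall A B C (g : alg_hom B C) (f : alg_hom A B) (x : sf_obj A),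
    sf_map (alg_comp g f) x = sf_map g (sf_map f x) }.

Record ring_functor (R : comPzRingType) := RingFunctor {
  rf_obj :> algebra R -> comPzRingType;
  rf_map : forall A B, alg_hom A B -> {rmorphism rf_obj A -> rf_obj B};
  rf_map_id : forall A (x : rf_obj A), rf_map (alg_id A) x = x;
  rf_map_comp : forall A B C (g : alg_hom B C) (f : alg_hom A B) (x : rf_obj A),
    rf_map (alg_comp g f) x = rf_map g (rf_map f x) }.

Record group_functor (R : comPzRingType) := GroupFunctor {
  gf_obj :> algebra R -> groupType;
  gf_map : forall A B, alg_hom A B -> {multiplicative gf_obj A -> gf_obj B};
  gf_map_id : forall A (x : gf_obj A), gf_map (alg_id A) x = x;
  gf_map_comp : forall A B C (g : alg_hom B C) (f : alg_hom A B) (x : gf_obj A),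
    gf_map (alg_comp g f) x = gf_map g (gf_map f x) }.

Arguments sf_map {R} _ {A B} _ _.
Arguments rf_map {R} _ {A B} _.
Arguments gf_map {R} _ {A B} _.

Definition set_of_ring_functor (R : comPzRingType) (F : ring_functor R) :
    set_functor R :=
  @SetFunctor R (fun A => F A) (fun A B f => rf_map F f) (@rf_map_id R F) (@rf_map_comp R F).

Definition set_of_group_functor (R : comPzRingType) (F : group_functor R) :
    set_functor R :=
  @SetFunctor R (fun A => F A) (fun A B f => gf_map F f) (@gf_map_id R F) (@gf_map_comp R F).

Record set_functor_hom (R : comPzRingType) (F G : set_functor R) :=
  SetFunctorHom {
    sf_app :> forall A, F A -> G A;
    sf_nat : forall A B (f : alg_hom A B) x,
      sf_app (sf_map F f x) = sf_map G f (sf_app x) }.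

Record ring_functor_hom (R : comPzRingType) (F G : ring_functor R) :=
  RingFunctorHom {
    rf_app :> forall A, {rmorphism F A -> G A};
    rf_nat : forall A B (f : alg_hom A B) x,
      rf_app B (rf_map F f x) = rf_map G f (rf_app A x) }.

Record group_functor_hom (R : comPzRingType) (F G : group_functor R) :=
  GroupFunctorHom {
    gf_app :> forall A, {multiplicative F A -> G A};
    gf_nat : forall A B (f : alg_hom A B) x,
      gf_app B (gf_map F f x) = gf_map G f (gf_app A x) }.

Definition set_of_ring_functor_hom (R : comPzRingType) (F G : ring_functor R)
    (u : ring_functor_hom F G) :
    set_functor_hom (set_of_ring_functor F) (set_of_ring_functor G) :=
  @SetFunctorHom R (set_of_ring_functor F) (set_of_ring_functor G)
    (fun A => rf_app u A) (@rf_nat R F G u).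

Definition set_functor_iso (R : comPzRingType) (F G : set_functor R) : Prop :=
  exists u : set_functor_hom F G, forall A, bijective (@sf_app R F G u A).

Definition spec_functor (R : comPzRingType) (A : algebra R) : set_functor R.
Proof.
refine (@SetFunctor R (fun B => alg_hom A B) (fun B C g f => alg_comp g f) _ _).
- by move=> B f; exact: alg_hom_ext.
- by move=> B C D g f x; exact: alg_hom_ext.
Defined.

(* By Yoneda's lemma, [a] identifies [F] with [Spec A]. *)
Definition universal_point (R : comPzRingType) (F : set_functor R)
    (A : algebra R) (a : F A) : Prop :=
  forall (B : algebra R) (x : F B), exists! f : alg_hom A B, sf_map F f a = x.

Definition is_affine_scheme (R : comPzRingType) (F : set_functor R) : Prop :=
  exists (A : algebra R) (a : F A), universal_point a.

(* [phi] is the comorphism of [u : Spec A -> Spec B]; the condition does not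
   depend on the choice of the coordinate rings [A] and [B]. *)
Definition universal_homeomorphism (R : comPzRingType) (F G : set_functor R)
    (u : set_functor_hom F G) : Prop :=
  exists (A : algebra R) (a : F A) (B : algebra R) (b : G B)
    (phi : alg_hom B A),
    [/\ universal_point a, universal_point b, sf_map G phi b = u A a &
        universal_homeomorphism_ring phi].

Section RestrictFunctor.
Variables (R S : comPzRingType) (phi : {rmorphism R -> S}).

(* The base change of a scheme along [Spec S -> Spec R], in terms of functors
   of points. *)
Definition base_change (F : ring_functor R) : ring_functor S.
Proof.
refine (@RingFunctor S (fun A => F (restr phi A))
  (fun A B f => rf_map F (restr_hom phi f)) _ _).
- move=> A x; have -> : restr_hom phi (alg_id A) = alg_id (restr phi A).
    exact: alg_hom_ext.
  exact: rf_map_id.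
- move=> A B C g f x.
  have -> : restr_hom phi (alg_comp g f) =
      alg_comp (restr_hom phi g) (restr_hom phi f) by exact: alg_hom_ext.
  exact: rf_map_comp.
Defined.

Definition base_change_hom (F G : ring_functor R) (u : ring_functor_hom F G) :
    ring_functor_hom (base_change F) (base_change G) :=
  @RingFunctorHom S (base_change F) (base_change G)
    (fun A => rf_app u (restr phi A))
    (fun A B f => rf_nat u (restr_hom phi f)).
End RestrictFunctor.

Section Kernel.
Variables (R : comPzRingType) (F G : ring_functor R).
Variable u : ring_functor_hom F G.

Section Points.
Variable A : algebra R.

Definition ker_pt : Type := {x : F A | u A x == 0}.
HB.instance Definition _ := SubChoice.on ker_pt.

Lemma ker_addP (x y : ker_pt) : u A (val x + val y) == 0.
Proof. by rewrite rmorphD (eqP (valP x)) (eqP (valP y)) addr0. Qed.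

Lemma ker_oppP (x : ker_pt) : u A (- val x) == 0.
Proof. by rewrite rmorphN (eqP (valP x)) oppr0. Qed.

Lemma ker_zeroP : u A 0 == 0.
Proof. by rewrite rmorph0. Qed.

Definition ker_zero : ker_pt := exist (fun z => is_true (u A z == 0)) 0 ker_zeroP.
Definition ker_opp (x : ker_pt) : ker_pt := exist (fun z => is_true (u A z == 0)) _ (ker_oppP x).
Definition ker_add (x y : ker_pt) : ker_pt := exist (fun z => is_true (u A z == 0)) _ (ker_addP x y).

Lemma ker_addA : associative ker_add.
Proof. by move=> x y z; apply: val_inj; rewrite /= addrA. Qed.
Lemma ker_add0 : left_id ker_zero ker_add.
Proof. by move=> x; apply: val_inj; rewrite /= add0r. Qed.
Lemma ker_addr0 : right_id ker_zero ker_add.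
Proof. by move=> x; apply: val_inj; rewrite /= addr0. Qed.
Lemma ker_addN : left_inverse ker_zero ker_opp ker_add.
Proof. by move=> x; apply: val_inj; rewrite /= addNr. Qed.
Lemma ker_addrN : right_inverse ker_zero ker_opp ker_add.
Proof. by move=> x; apply: val_inj; rewrite /= addrN. Qed.

HB.instance Definition _ :=
  isGroup.Build ker_pt ker_addA ker_add0 ker_addr0 ker_addN ker_addrN.
End Points.

Section Map.
Variables (A B : algebra R) (f : alg_hom A B).

Lemma ker_mapP (x : ker_pt A) : u B (rf_map F f (val x)) == 0.
Proof. by rewrite rf_nat (eqP (valP x)) rmorph0. Qed.

Definition ker_map (x : ker_pt A) : ker_pt B := exist (fun z => is_true (u B z == 0)) _ (ker_mapP x).

Lemma ker_mapM : {morph ker_map : x y / (x * y)%g}.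
Proof. by move=> x y; apply: val_inj; rewrite /= rmorphD. Qed.

HB.instance Definition _ :=
  monoid.isMultiplicative.Build (ker_pt A) (ker_pt B) ker_map ker_mapM.
End Map.

Definition kernel : group_functor R.
Proof.
refine (@GroupFunctor R ker_pt
  (fun A B f => ker_map f : {multiplicative ker_pt A -> ker_pt B}) _ _).
- by move=> A x; apply: val_inj; rewrite /= rf_map_id.
- by move=> A B C g f x; apply: val_inj; rewrite /= rf_map_comp.
Defined.
End Kernel.

Definition finite_dimensional (k : fieldType) (A : algebra k) : Prop :=
  exists n (v : 'I_n -> A), forall x : A, exists c : 'I_n -> k,
    x = \sum_(i < n) alg_map A (c i) * v i.

Definition infinitesimal (k : fieldType) (G : group_functor k) : Prop :=
  exists (A : algebra k) (a : set_of_group_functor G A),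
    [/\ universal_point a, finite_dimensional A &
        exists p : spec A, forall p' : spec A, p' = p].

(* Limits of functors are computed pointwise. *)
Definition pro_infinitesimal (k : fieldType) (G : group_functor k) : Prop :=
  is_affine_scheme (set_of_group_functor G) /\
  exists (I : Type) (le : I -> I -> Prop) (H : I -> group_functor k)
    (t : forall i j, le i j -> group_functor_hom (H j) (H i))
    (p : forall i, group_functor_hom G (H i)),
    [/\ [/\ inhabited I, forall i, le i i,
            forall i j l, le i j -> le j l -> le i l &
            forall i j, exists l, le i l /\ le j l],
        forall i, infinitesimal (H i),
        (forall i (l : le i i) (A : algebra k) (x : H i A), t i i l A x = x) /\
        (forall i j l (a : le i j) (b : le j l) (c : le i l) (A : algebra k)
          (x : H l A), t i l c A x = t i j a A (t j l b A x)),
        forall i j (a : le i j) (A : algebra k) (x : G A),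
          t i j a A (p j A x) = p i A x &
        forall (A : algebra k) (y : forall i, H i A),
          (forall i j (a : le i j), t i j a A (y j) = y i) ->
          exists! x : G A, forall i, p i A x = y i].

Section Witt.
Variables (O : comPzRingType) (pi : O) (q : nat).

Definition ghost (B : algebra O) (b : nat -> B) (n : nat) : B :=
  \sum_(i < n.+1) alg_map B (pi ^+ i) * b i ^+ (q ^ (n - i)).

(* The functorial O-algebra structure on the sets [nat -> B]; the bijection
   [witt_coord] transports the structure of [witt_alg B] to [nat -> B].  When
   [O] is a complete discrete valuation ring with uniformizer [pi] and residue
   field of cardinality [q], these data exist and are unique. *)
Record witt := Witt {
  witt_alg :> algebra O -> algebra O;
  witt_coord : forall B, witt_alg B -> nat -> B;
  witt_coord_bij : forall B, bijective (@witt_coord B);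
  witt_map : forall B C, alg_hom B C -> alg_hom (witt_alg B) (witt_alg C);
  witt_mapE : forall B C (f : alg_hom B C) b n,
    witt_coord (witt_map f b) n = f (witt_coord b n);
  witt_ghost : forall B n, exists h : alg_hom (witt_alg B) B,
    forall b, h b = ghost (@witt_coord B b) n }.

Variable W : witt.

Definition witt_functor : ring_functor O.
Proof.
refine (@RingFunctor O (fun A => W A) (fun A B f => alg_fun (witt_map W f)) _ _).
- move=> A x; apply: (bij_inj (@witt_coord_bij W A)); apply: funext => n.
  by rewrite witt_mapE.
- move=> A B C g f x.
  apply: (bij_inj (@witt_coord_bij W C)); apply: funext => n.
  by rewrite !witt_mapE.
Defined.
End Witt.

Section Drinfeld.
Variables (O O' : comPzRingType) (iota : {rmorphism O -> O'}).
Variables (pi : O) (varpi : O') (q : nat).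
Variables (W : witt pi q) (W' : witt varpi q).

(* Drinfeld's morphism when the residue fields of O and O' coincide. *)
Record drinfeld := Drinfeld {
  dr_map :> forall B : algebra O',
    alg_hom (W (restr iota B)) (restr iota (W' B));
  dr_nat : forall (B C : algebra O') (f : alg_hom B C) b,
    dr_map C (witt_map W (restr_hom iota f) b) = witt_map W' f (dr_map B b);
  dr_ghost : forall (B : algebra O') (b : W (restr iota B)) n,
    ghost varpi q (witt_coord (dr_map B b : W' B)) n =
    ghost pi q (witt_coord b) n }.

Variable T : forall A : algebra O, tensor (alg_map (W A)) iota.

Section TensorMap.
Variables (A B : algebra O) (f : alg_hom A B).

Lemma tensor_map_comm r :
  (tens_l (T B) \o witt_map W f) (alg_map (W A) r) = tens_r (T B) (iota r).
Proof. by rewrite /= alg_funE tens_comm. Qed.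

Definition tensor_map : {rmorphism T A -> T B} :=
  tens_copair (T A) tensor_map_comm.
End TensorMap.

(* \prod^varpi W_O represents A |-> W_O(A) (x)_O O'.  As O' is the direct sum of
   the O varpi^i for i < e, its points are uniquely of the form
   \sum_i b_i (x) varpi^i, and \prod_(i < e) W_O is its underlying additive
   group scheme. *)
Definition prod_witt : ring_functor O.
Proof.
refine (@RingFunctor O (fun A => T A) tensor_map _ _).
- move=> A x; apply: (tens_ext (h := tensor_map (alg_id A)) (k := idfun)) => y.
    rewrite /tensor_map tens_copair_l /=; congr (tens_l _ _).
    exact: (@rf_map_id _ (witt_functor W)).
  by rewrite /tensor_map tens_copair_r.
- move=> A B C g f x.
  apply: (tens_ext (k := tensor_map g \o tensor_map f)) => y /=.
    rewrite /tensor_map !tens_copair_l /=; congr (tens_l _ _).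
    exact: (@rf_map_comp _ (witt_functor W)).
  by rewrite /tensor_map !tens_copair_r.
Defined.

Variable u : drinfeld.

Section Points.
Variable B : algebra O'.

Lemma u_ra_comm r :
  alg_fun (u B) (alg_map (W (restr iota B)) r) = alg_map (W' B) (iota r).
Proof. by rewrite alg_funE. Qed.

(* b (x) x |-> u_B(b) x *)
Definition u_ra_map : {rmorphism T (restr iota B) -> W' B} :=
  tens_copair (T (restr iota B)) u_ra_comm.
End Points.

Definition u_ra :
  ring_functor_hom (base_change iota prod_witt) (witt_functor W').
Proof.
refine (@RingFunctorHom O' (base_change iota prod_witt) (witt_functor W')
  u_ra_map _).
move=> A B f x.
apply: (tens_ext (h := u_ra_map B \o tensor_map (restr_hom iota f))
  (k := alg_fun (witt_map W' f) \o u_ra_map A)) => y /=.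
  by rewrite /tensor_map /u_ra_map !tens_copair_l /= dr_nat.
by rewrite /tensor_map /u_ra_map !tens_copair_r alg_funE.
Defined.
End Drinfeld.

Section DVR.
Variable O : idomainType.

Definition is_dvr : Prop :=
  [/\ forall I : set O, is_ideal I ->
        exists a, forall x, I x <-> exists c, x = c * a,
      forall x y : O, x \isn't a GRing.unit -> y \isn't a GRing.unit ->
        x + y \isn't a GRing.unit &
      exists x : O, x != 0 /\ x \isn't a GRing.unit].

(* In a local ring: [pi] generates the maximal ideal. *)
Definition is_uniformizer (pi : O) : Prop :=
  forall x, x \isn't a GRing.unit <-> exists c, x = c * pi.

Definition adically_complete (pi : O) : Prop :=
  forall x : nat -> O,
    (forall n, exists N, forall i j, (N <= i)%N -> (N <= j)%N ->
      exists c, x i - x j = c * pi ^+ n) ->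
    exists l, forall n, exists N, forall i, (N <= i)%N ->
      exists c, x i - l = c * pi ^+ n.

Definition is_residue_map (k : fieldType) (rho : {rmorphism O -> k}) : Prop :=
  (forall y, exists x, rho x = y) /\
  (forall x, rho x = 0 <-> x \isn't a GRing.unit).

Definition is_integral_closure (K' : fieldExtType {fraction O})
    (O' : idomainType) (j : {rmorphism O' -> K'}) : Prop :=
  injective j /\
  forall x : K', (exists a, j a = x) <->
    integralOver (fun r : O => (tofrac r)%:A : K') x.
End DVR.

(* The ramification index of O'/O equals the degree [e] of the extension of
   fraction fields. *)
Definition totally_ramified (O : idomainType) (K' : fieldExtType {fraction O})
    (O' : idomainType) (iota : {rmorphism O -> O'}) (pi : O) (varpi : O')
    (e : nat) : Prop :=
  \dim {: K'} = e /\
  exists2 v : O', v \is a GRing.unit & iota pi = v * varpi ^+ e.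

Section KernelRing.
Variables (k : fieldType) (q e : nat).

Definition polyring : comPzRingType := {malg k[{cmonom (nat * 'I_e)%type}]}.

Definition polyvar (n : nat) (i : 'I_e) : polyring :=
  mkmalgU (ucm (n, i)) 1.

Definition ker_relations : set polyring :=
  fun x => exists n i, x = polyvar n i ^+ (q ^ (n * (e - 1) + i)).

Definition ker_ring : algebra k :=
  Algebra (@quot_proj polyring ker_relations \o
    (GRing.in_alg {malg k[{cmonom (nat * 'I_e)%type}]} : {rmorphism k -> polyring})).
End KernelRing.

(* Main.v *)
Require Import Defs.
From HB Require Import structures.
From mathcomp Require Import all_boot all_order all_fingroup all_algebra all_solvable all_field.
From mathcomp Require Import finmap generic_quotient boolp classical_sets functions topology.
From mathcomp Require Import monalg.

(* Write [V] for the Verschiebung, [c] for Teichmueller representatives and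
   [iota pi = v * varpi ^ e].  Comparing ghost components gives [u [c] = [c]]
   and [u (V x) = v varpi^(e-1) V (u x)], while [varpi [c] = V [c^q]] over an
   algebra where [varpi] vanishes.  Over such an algebra, u_ra therefore sends
   the point with coordinates [b_(n,i)] to the sum over (n, i) of
   [v^n V^(ne+i) [b_(n,i)^(q^(n(e-1)+i))]].  As [v] is a unit, every Witt vector
   over O' is uniquely a sum of [v^n V^(ne+i) [c_(n,i)]].  In these coordinates
   u_ra is the map raising the coordinate (n, i) to the power q^(n(e-1)+i),
   whose kernel is visible, and which is a universal homeomorphism because it
   becomes invertible after perfection. *)

Set Implicit Arguments.
Unset Strict Implicit.
Unset Printing Implicit Defensive.

Import GRing.Theory.
Local Open Scope ring_scope.

(** * Polynomial algebras *)

(** Over an algebra where [pi] vanishes the n-th ghost component is b_0^(q^n), which forgets every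
    later coordinate. Identities are therefore proved over a polynomial algebra, where the ghost map
    is injective, and pushed down. The exponent n(e-1)+i counts factors [varpi], each of which costs
    one Frobenius: each of the n Verschiebungs contributes e-1 of them, and the basis vector varpi^i
    contributes i. Two obstacles remain after this computation. Universality requires the kernel of
    C -> D to be nil after every base change, while D is known only by its universal property; a map
    from D to a ring containing q-power roots of elements of C detects this. And the group law of
    the kernel is not coordinatewise, but the coordinates with n < N of a sum depend only on those
    of the summands, because V^N W is a subgroup; this yields the infinitesimal quotients. *)

Section Evaluation.
Variables (R : comNzRingType) (I : choiceType).

Definition mpoly : comPzRingType := {malg R[{cmonom I}]}.

Definition mpoly_alg : algebra R :=
  Algebra (GRing.in_alg {malg R[{cmonom I}]} : {rmorphism R -> mpoly}).

Definition mpolyU (m : {cmonom I}) (c : R) : mpoly := mkmalgU m c.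

Definition mpoly_var (i : I) : mpoly := mpolyU (ucm i) 1.

Lemma mpolyE (g : mpoly) : g = \sum_(k <- msupp g) mpolyU k (mcoeff k g).
Proof. exact: monalgE. Qed.

Lemma mpolyUM m n c d : mpolyU m c * mpolyU n d = mpolyU (mmul m n) (c * d).
Proof. by rewrite [LHS]malgM_def fgmulUU. Qed.

Lemma mpoly_algE c : alg_map mpoly_alg c = mpolyU mone c.
Proof. by rewrite /= -mul_malgC mulr1. Qed.

Lemma mpolyCU m c : alg_map mpoly_alg c * mpolyU m 1 = mpolyU m c.
Proof. by rewrite mpoly_algE mpolyUM mulr1 mul1m. Qed.

Variables (B : algebra R) (y : I -> B).

Definition monom_eval (m : {cmonom I}) : B := \prod_(i <- finsupp m) y i ^+ m i.

Lemma monom_evalEw (m : {cmonom I}) (d : {fset I}) :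
  (finsupp m `<=` d)%fset -> monom_eval m = \prod_(i <- d) y i ^+ m i.
Proof.
move=> le_md; rewrite /monom_eval; apply: big_fset_incl => // i _.
by rewrite -cmE_eq0 => /eqP->.
Qed.

Lemma monom_evalM m n : monom_eval (mmul m n) = monom_eval m * monom_eval n.
Proof.
rewrite !(@monom_evalEw _ (finsupp m `|` finsupp n)%fset).
- by rewrite -big_split /=; apply: eq_bigr => i _; rewrite cmM exprD.
- exact: fsubsetUr.
- exact: fsubsetUl.
- by rewrite mdomD.
Qed.

Lemma monom_evalU i : monom_eval (ucm i) = y i.
Proof. by rewrite /monom_eval mdomU big_seq_fset1 cmUU. Qed.

Lemma monom_eval1 : monom_eval mone = 1.
Proof. by rewrite /monom_eval mdom1 big_seq_fset0. Qed.

Definition eval_fun (g : mpoly) : B :=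
  \sum_(k <- msupp g) alg_map B (mcoeff k g) * monom_eval k.

Lemma eval_funEw (g : mpoly) (d : {fset {cmonom I}}) : (msupp g `<=` d)%fset ->
  eval_fun g = \sum_(k <- d) alg_map B (mcoeff k g) * monom_eval k.
Proof.
move=> le_gd; rewrite /eval_fun; apply: big_fset_incl => // k _ /mcoeff_outdom ->.
by rewrite rmorph0 mul0r.
Qed.

Lemma eval_fun_zmod : zmod_morphism eval_fun.
Proof.
move=> g h; pose d := (msupp g `|` msupp h)%fset.
rewrite !(@eval_funEw _ d) ?fsubsetUl ?fsubsetUr ?msuppB_le //.
by rewrite -sumrB; apply: eq_bigr => k _; rewrite mcoeffB rmorphB mulrBl.
Qed.

HB.instance Definition _ := GRing.isZmodMorphism.Build mpoly B eval_fun eval_fun_zmod.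

Lemma eval_funU c m : eval_fun (mpolyU m c) = alg_map B c * monom_eval m.
Proof. by rewrite (eval_funEw msuppU_le) big_seq_fset1 mcoeffUU. Qed.

Lemma eval_fun_monoid : monoid_morphism eval_fun.
Proof.
split=> [|g h]; first by rewrite eval_funU rmorph1 mul1r monom_eval1.
rewrite [g in LHS]mpolyE [h in LHS]mpolyE mulr_suml raddf_sum [in RHS]/eval_fun mulr_suml.
apply: eq_bigr => k _; rewrite !mulr_sumr raddf_sum.
apply: eq_bigr => l _; rewrite mpolyUM /= eval_funU rmorphM monom_evalM.
by rewrite mulrACA.
Qed.

HB.instance Definition _ := GRing.isMonoidMorphism.Build mpoly B eval_fun eval_fun_monoid.

Lemma eval_funC r : eval_fun (alg_map mpoly_alg r) = alg_map B r.
Proof.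
rewrite mpoly_algE eval_funU monom_eval1; exact: mulr1.
Qed.

Definition mpoly_eval : alg_hom mpoly_alg B :=
  @AlgHom R mpoly_alg B (eval_fun : {rmorphism mpoly -> B}) eval_funC.

Lemma mpoly_eval_var i : mpoly_eval (mpoly_var i) = y i.
Proof.
by rewrite [LHS]eval_funU rmorph1 mul1r monom_evalU.
Qed.
End Evaluation.

Section PolynomialAlgebra.
Variables (R : comNzRingType) (I : choiceType).

(** Both sides have the same exponents. Monomials thus become products of variables, which is what
    [mpoly_ind] needs. *)
Lemma cmonomE (m : {cmonom I}) :
  m = \big[mmul/mone]_(i <- finsupp m) iterop (m i) mmul (ucm i) mone.
Proof.
apply/eqP/cmP => i.
rewrite (big_morph (fun m : {cmonom I} => m i) (fun a b => cmM i a b) (cm1 i)).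
have E k : (iterop (m k) mmul (ucm k) mone : {cmonom I}) i = (m k * (k == i))%N.
  elim: (m k) => [|[|n] IHn]; first by rewrite cm1.
    by rewrite cmU mul1n.
  rewrite [iterop _ _ _ _]/(mmul (ucm k) (iterop n.+1 mmul (ucm k) mone)).
  by rewrite cmM IHn cmU mulSn.
rewrite (eq_bigr _ (fun k _ => E k)).
have [im|im] := boolP (i \in finsupp m); last first.
  move: (im); rewrite -cmE_eq0 => /eqP ->; rewrite big1_seq // => k /andP[_ km].
  by case: eqP => [ki|]; rewrite ?muln0 //; case/negP: im; rewrite -ki.
rewrite (big_fsetD1 i) //= eqxx muln1 big1_seq ?addn0 // => k.
by rewrite in_fsetD1 /= => /andP[/negbTE-> _]; rewrite muln0.
Qed.

Lemma mpolyU1 : mpolyU mone (1 : R) = 1 :> mpoly R I.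
Proof. exact: erefl. Qed.

Lemma mpolyU_prod (m : {cmonom I}) :
  mpolyU m (1 : R) = \prod_(i <- finsupp m) mpoly_var R i ^+ m i.
Proof.
rewrite [X in mpolyU X _]cmonomE.
rewrite (big_morph (fun m => mpolyU m (1 : R)) (id1 := 1) (op1 := *%R)); last 2 first.
- by move=> a b; rewrite mpolyUM mulr1.
- exact: mpolyU1.
apply: eq_bigr => i _; elim: (m i) => [|[_|n IHn]].
- by rewrite expr0 -mpolyU1.
- by rewrite expr1.
- by rewrite exprS -IHn mpolyUM mulr1.
Qed.

Lemma mpoly_ind (P : mpoly R I -> Prop) :
    (forall c, P (alg_map (mpoly_alg R I) c)) -> (forall i, P (mpoly_var R i)) ->
    (forall x y, P x -> P y -> P (x + y)) -> (forall x y, P x -> P y -> P (x * y)) ->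
  forall x, P x.
Proof.
move=> Pc Pv PD PM x; rewrite [x]mpolyE.
have P0 : P 0 by rewrite -(rmorph0 (alg_map (mpoly_alg R I))); exact: Pc.
have P1 : P 1 by rewrite -(rmorph1 (alg_map (mpoly_alg R I))); exact: Pc.
apply: (big_ind P P0 PD) => m _; rewrite -mpolyCU; apply: (PM _ _ (Pc _)).
rewrite mpolyU_prod.
apply: (big_ind P P1 PM) => i _; elim: (m i) => [|n IHn]; first by rewrite expr0.
by rewrite exprS; exact: (PM _ _ (Pv i) IHn).
Qed.

Lemma mpoly_hom_ext (B : algebra R) (f g : alg_hom (mpoly_alg R I) B) :
  (forall i, f (mpoly_var R i) = g (mpoly_var R i)) -> f = g.
Proof.
move=> fg; apply: alg_hom_ext; apply: mpoly_ind => //.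
- by move=> c; rewrite !alg_funE.
- by move=> x y fx fy; rewrite !rmorphD fx fy.
- by move=> x y fx fy; rewrite !rmorphM fx fy.
Qed.
End PolynomialAlgebra.

Lemma mpoly_torsion_free (R : idomainType) (I : choiceType) (c : R) (p : mpoly R I) :
  c != 0 -> alg_map (mpoly_alg R I) c * p = 0 -> p = 0.
Proof.
move=> c0; rewrite /= -scalerAl mul1r => cp0; apply/malgP => k.
have /eqP := congr1 (mcoeff k) cp0.
by rewrite mcoeffZ !mcoeff0 mulf_eq0 (negbTE c0) => /eqP.
Qed.

(** * Commutative rings *)

(** Serves [tensor_ind]: a tensor product known only by its universal property is shown to be
    generated by its two factors by mapping it into a subring. *)
Record subring_pred (A : comPzRingType) := SubringPred {
  in_subring :> A -> Prop;
  in_subring1 : in_subring 1;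
  in_subringB : forall x y, in_subring x -> in_subring y -> in_subring (x - y);
  in_subringM : forall x y, in_subring x -> in_subring y -> in_subring (x * y) }.

Section Subring.
Variables (A : comPzRingType) (P : subring_pred A).
Let P1 := in_subring1 P.
Let PB := @in_subringB A P.
Let PM := @in_subringM A P.

Definition subring : Type := {x : A | `[< P x >]}.
HB.instance Definition _ := SubChoice.on subring.

Let sub (x : A) (Px : P x) : subring := exist (fun x => is_true `[< P x >]) x (asboolT Px).
Let subP (x : subring) : P (val x) := asboolW (valP x).
Let P0 : P 0. Proof. by rewrite -(subrr 1); exact: PB. Qed.
Let PN x : P x -> P (- x). Proof. by move=> Px; rewrite -sub0r; exact: PB. Qed.
Let PD x y : P x -> P y -> P (x + y).
Proof. by move=> Px Py; rewrite -[y]opprK; apply/PB/PN. Qed.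

Definition subring_zero := sub P0.
Definition subring_one := sub P1.
Definition subring_opp x := sub (PN (subP x)).
Definition subring_add x y := sub (PD (subP x) (subP y)).
Definition subring_mul x y := sub (PM (subP x) (subP y)).

Lemma subring_addA : associative subring_add.
Proof. by move=> x y z; apply: val_inj; rewrite /= addrA. Qed.
Lemma subring_addC : commutative subring_add.
Proof. by move=> x y; apply: val_inj; rewrite /= addrC. Qed.
Lemma subring_add0 : left_id subring_zero subring_add.
Proof. by move=> x; apply: val_inj; rewrite /= add0r. Qed.
Lemma subring_addN : left_inverse subring_zero subring_opp subring_add.
Proof. by move=> x; apply: val_inj; rewrite /= addNr. Qed.
HB.instance Definition _ := GRing.isZmodule.Build subring
  subring_addA subring_addC subring_add0 subring_addN.

Lemma subring_mulA : associative subring_mul.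
Proof. by move=> x y z; apply: val_inj; rewrite /= mulrA. Qed.
Lemma subring_mulC : commutative subring_mul.
Proof. by move=> x y; apply: val_inj; rewrite /= mulrC. Qed.
Lemma subring_mul1 : left_id subring_one subring_mul.
Proof. by move=> x; apply: val_inj; rewrite /= mul1r. Qed.
Lemma subring_mulDl : left_distributive subring_mul subring_add.
Proof. by move=> x y z; apply: val_inj; rewrite /= mulrDl. Qed.
HB.instance Definition _ := GRing.Zmodule_isComPzRing.Build subring
  subring_mulA subring_mulC subring_mul1 subring_mulDl.

Definition subring_val (x : subring) : A := val x.
Fact subring_val_zmod : zmod_morphism subring_val. Proof. by []. Qed.
Fact subring_val_monoid : monoid_morphism subring_val. Proof. by []. Qed.
HB.instance Definition _ :=
  GRing.isZmodMorphism.Build subring A subring_val subring_val_zmod.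
HB.instance Definition _ :=
  GRing.isMonoidMorphism.Build subring A subring_val subring_val_monoid.

Section Corestriction.
Variables (B : comPzRingType) (f : {rmorphism B -> A}) (fP : forall b, P (f b)).
Definition corestr (b : B) : subring := sub (fP b).
Fact corestr_zmod : zmod_morphism corestr.
Proof. by move=> x y; apply: val_inj; rewrite /= rmorphB. Qed.
Fact corestr_monoid : monoid_morphism corestr.
Proof. by split=> [|x y]; apply: val_inj; rewrite /= ?rmorph1 ?rmorphM. Qed.
HB.instance Definition _ := GRing.isZmodMorphism.Build B subring corestr corestr_zmod.
HB.instance Definition _ :=
  GRing.isMonoidMorphism.Build B subring corestr corestr_monoid.
End Corestriction.
End Subring.

(* The copairing into the subring [P] followed by the inclusion is the identity. *)
Lemma tensor_ind (R A B : comPzRingType) (f : {rmorphism R -> A})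
    (g : {rmorphism R -> B}) (D : tensor f g) (P : D -> Prop) :
    (forall a, P (tens_l D a)) -> (forall b, P (tens_r D b)) ->
    (forall x y, P x -> P y -> P (x - y)) -> (forall x y, P x -> P y -> P (x * y)) ->
  forall d, P d.
Proof.
move=> Pl Pr PB PM.
have P1 : P 1 by rewrite -(rmorph1 (tens_l D)).
pose S := SubringPred P1 PB PM.
pose h := corestr (P := S) Pl : {rmorphism A -> subring S}.
pose k := corestr (P := S) Pr : {rmorphism B -> subring S}.
have hk r : h (f r) = k (g r) by apply: val_inj; exact: (tens_comm D).
pose c := tens_copair D hk.
have cE : (@subring_val _ S \o c) =1 idfun.
  by apply: tens_ext => x /=; rewrite /c ?tens_copair_l ?tens_copair_r.
by move=> d; rewrite -[d]cE /=; exact: asboolW (valP (c d)).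
Qed.

Lemma exprDn_prime (A : comPzRingType) p (x y : A) :
  prime p -> p%:R = 0 :> A -> (x + y) ^+ p = x ^+ p + y ^+ p.
Proof.
move=> p_pr p0; have := prime_gt0 p_pr; case: p p_pr p0 => // p p_pr p0 _.
rewrite exprDn big_ord_recl big_ord_recr /= subn0 expr0 mulr1 bin0 mulr1n.
rewrite /bump /= add1n subnn expr0 mul1r binn mulr1n big1 ?add0r // => i _.
have /dvdnP[m ->] : (p.+1 %| 'C(p.+1, 1 + i))%N by apply: prime_dvd_bin; rewrite // add1n /= ltnS.
by rewrite mulrnA -mulr_natl p0 mul0r.
Qed.

(** * Ramified Witt vectors *)

Section WittTheory.
Variables (O : idomainType) (pi : O) (q : nat) (W : witt pi q).
Hypotheses (pi_neq0 : pi != 0) (q_gt1 : (1 < q)%N).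

Section Coordinates.
Variable B : algebra O.

Lemma witt_of_seq_subproof : exists g, cancel g (@witt_coord _ _ _ W B).
Proof. by have [g _ gK] := witt_coord_bij W B; exists g. Qed.

Definition witt_of_seq : (nat -> B) -> W B := sval (cid witt_of_seq_subproof).

Lemma witt_of_seqK b n : witt_coord (witt_of_seq b) n = b n.
Proof. by rewrite /witt_of_seq; case: cid => g /= ->. Qed.

Lemma witt_ext (x y : W B) : (forall n, witt_coord x n = witt_coord y n) -> x = y.
Proof. by move=> xy; apply: (bij_inj (witt_coord_bij W B)); exact: funext. Qed.

(** A left inverse of [witt_V]. It is not additive in general, since the sum of two Witt vectors
    carries from coordinate 0 into the later ones. *)
Definition witt_shift (x : W B) : W B := witt_of_seq (fun n => witt_coord x n.+1).

Definition witt_V (x : W B) : W B :=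
  witt_of_seq (fun n => if n is k.+1 then witt_coord x k else 0).

Definition teich (c : B) : W B := witt_of_seq (fun n => if n is 0 then c else 0).

Definition wghost (x : W B) n : B := ghost pi q (witt_coord x) n.

Lemma wghostB x y n : wghost (x - y) n = wghost x n - wghost y n.
Proof. by have [h hE] := witt_ghost W B n; rewrite /wghost -!hE rmorphB. Qed.

Lemma wghostD x y n : wghost (x + y) n = wghost x n + wghost y n.
Proof. by have [h hE] := witt_ghost W B n; rewrite /wghost -!hE rmorphD. Qed.

Lemma wghostM x y n : wghost (x * y) n = wghost x n * wghost y n.
Proof. by have [h hE] := witt_ghost W B n; rewrite /wghost -!hE rmorphM. Qed.

Lemma wghostC r n : wghost (alg_map (W B) r) n = alg_map B r.
Proof. by have [h hE] := witt_ghost W B n; rewrite /wghost -!hE alg_funE. Qed.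

Lemma ghost0E b : ghost pi q b 0 = b 0%N :> B.
Proof. by rewrite /ghost big_ord1 /= expr0 rmorph1 mul1r subnn expn0 expr1. Qed.

Lemma ghostSl b n :
  ghost pi q b n.+1 = b 0%N ^+ (q ^ n.+1) + alg_map B pi * ghost pi q (fun i => b i.+1) n.
Proof.
rewrite /ghost big_ord_recl /= expr0 rmorph1 mul1r subn0; congr (_ + _).
by rewrite mulr_sumr; apply: eq_bigr => i _; rewrite exprS rmorphM mulrA.
Qed.

Lemma ghostE b n :
  ghost pi q b n = \sum_(i < n) alg_map B (pi ^+ i) * b i ^+ (q ^ (n - i)) +
    alg_map B (pi ^+ n) * b n.
Proof. by rewrite /ghost big_ord_recr /= subnn expn0 expr1. Qed.

Lemma wghost_V0 x : wghost (witt_V x) 0 = 0.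
Proof. by rewrite /wghost ghost0E witt_of_seqK. Qed.

Lemma wghost_VS x n : wghost (witt_V x) n.+1 = alg_map B pi * wghost x n.
Proof.
rewrite /wghost ghostSl witt_of_seqK expr0n expn_eq0 -leqn0 leqNgt (ltnW q_gt1) add0r.
by congr (_ * _); apply: eq_bigr => i _; rewrite witt_of_seqK.
Qed.

Lemma wghost_teich c n : wghost (teich c) n = c ^+ (q ^ n).
Proof.
case: n => [|n]; first by rewrite /wghost ghost0E witt_of_seqK expn0 expr1.
rewrite /wghost ghostSl witt_of_seqK [X in _ * X]big1 ?mulr0 ?addr0 // => i _.
by rewrite witt_of_seqK expr0n expn_eq0 -leqn0 leqNgt (ltnW q_gt1) mulr0.
Qed.

Lemma witt_V_inj : injective witt_V.
Proof.
move=> x y xy; apply: witt_ext => n.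
by have := congr1 (fun z : W B => witt_coord z n.+1) xy; rewrite !witt_of_seqK.
Qed.

Lemma coord0B (x y : W B) : witt_coord (x - y) 0 = witt_coord x 0 - witt_coord y 0.
Proof. by have := wghostB x y 0; rewrite /wghost !ghost0E. Qed.

Lemma coord0D (x y : W B) : witt_coord (x + y) 0 = witt_coord x 0 + witt_coord y 0.
Proof. by have := wghostD x y 0; rewrite /wghost !ghost0E. Qed.

Lemma coord0M (x y : W B) : witt_coord (x * y) 0 = witt_coord x 0 * witt_coord y 0.
Proof. by have := wghostM x y 0; rewrite /wghost !ghost0E. Qed.

Lemma coord0C r : witt_coord (alg_map (W B) r) 0 = alg_map B r.
Proof. by have := wghostC r 0; rewrite /wghost !ghost0E. Qed.

Lemma coord0_V x : witt_coord (witt_V x) 0 = 0.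
Proof. by rewrite witt_of_seqK. Qed.

Lemma coord0_teich c : witt_coord (teich c) 0 = c.
Proof. by rewrite witt_of_seqK. Qed.

Definition torsion_free := forall p : B, alg_map B pi * p = 0 -> p = 0.

Lemma torsion_freeX n p : torsion_free -> alg_map B (pi ^+ n) * p = 0 -> p = 0.
Proof.
move=> tf; elim: n => [|n IHn]; first by rewrite expr0 rmorph1 mul1r.
by rewrite exprS rmorphM -mulrA => /tf.
Qed.

(** The n-th ghost component is pi^n b_n plus an expression in the earlier coordinates, so b_n is
    recovered by induction once pi^n can be cancelled. *)
Lemma ghost_inj x y : torsion_free -> (forall n, wghost x n = wghost y n) -> x = y.
Proof.
move=> tf xy; apply: witt_ext => n; have [m] := ubnP n.
elim: m n => // m IHm n; rewrite ltnS => nm.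
have := xy n; rewrite /wghost !ghostE.
rewrite (eq_bigr (fun i : 'I_n => alg_map B (pi ^+ i) * witt_coord y i ^+ (q ^ (n - i)))).
  move=> /addrI/eqP; rewrite -subr_eq0 -mulrBr => /eqP /torsion_freeX - /(_ tf) /eqP.
  by rewrite subr_eq0 => /eqP.
by move=> i _; rewrite IHm // (leq_trans (ltn_ord i)).
Qed.
End Coordinates.

Arguments witt_V {B}.
Arguments witt_shift {B}.

Section Naturality.
Variables (B C : algebra O) (f : alg_hom B C).

Lemma witt_map_V x : witt_map W f (witt_V x) = witt_V (witt_map W f x).
Proof.
apply: witt_ext => -[|n]; rewrite witt_mapE !witt_of_seqK ?rmorph0 //.
by rewrite witt_mapE.
Qed.

Lemma witt_map_iterV n x : witt_map W f (iter n witt_V x) = iter n witt_V (witt_map W f x).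
Proof. by elim: n => //= n IHn; rewrite witt_map_V IHn. Qed.

Lemma witt_map_shift x : witt_map W f (witt_shift x) = witt_shift (witt_map W f x).
Proof. by apply: witt_ext => n; rewrite witt_mapE !witt_of_seqK witt_mapE. Qed.

Lemma witt_map_teich c : witt_map W f (teich c) = teich (f c).
Proof. by apply: witt_ext => -[|n]; rewrite witt_mapE !witt_of_seqK ?rmorph0. Qed.
End Naturality.

(* The polynomial ring on the set [B] is a torsion-free algebra that surjects
   onto [B]; this reduces identities in [W B] to ghost components. *)
Lemma witt_lift (B : algebra O) : exists (P : algebra O) (f : alg_hom P B),
  [/\ torsion_free P, forall c, exists p, f p = c & forall x, exists y, witt_map W f y = x].
Proof.
pose f := @mpoly_eval O B B id.
have f_surj c : exists p, f p = c by exists (mpoly_var O (c : B)); exact: mpoly_eval_var.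
exists (mpoly_alg O B), f; split=> //.
  by move=> p; exact: mpoly_torsion_free.
move=> x; have [y yE] := choice (fun n => f_surj (witt_coord x n)).
by exists (witt_of_seq y); apply: witt_ext => n; rewrite witt_mapE witt_of_seqK yE.
Qed.

Section Identities.
Variable B : algebra O.
Implicit Types (x y : W B).

Lemma witt_VB x y : witt_V (x - y) = witt_V x - witt_V y.
Proof.
have [P [f [tf _ fS]]] := witt_lift B; have [x' <-] := fS x; have [y' <-] := fS y.
rewrite -rmorphB -!witt_map_V -rmorphB; congr (witt_map W f _).
apply: ghost_inj => // -[|n]; rewrite wghostB ?wghost_V0 ?subrr //.
by rewrite !wghost_VS wghostB mulrBr.
Qed.

HB.instance Definition _ := GRing.isZmodMorphism.Build (W B) (W B) witt_V witt_VB.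

Lemma witt_VZ r x : witt_V (alg_map (W B) r * x) = alg_map (W B) r * witt_V x.
Proof.
have [P [f [tf _ fS]]] := witt_lift B; have [x' <-] := fS x.
rewrite -!(alg_funE (witt_map W f)) -rmorphM -!witt_map_V -rmorphM; congr (witt_map W f _).
apply: ghost_inj => // -[|n]; rewrite wghostM ?wghost_V0 ?mulr0 //.
by rewrite !wghost_VS wghostM !wghostC mulrCA.
Qed.

(** Adding a Teichmueller representative to an element of V W produces no carry: this is the
    recursion [ghostSl] read on ghost components. *)
Lemma witt_decomp x : x = teich (witt_coord x 0) + witt_V (witt_shift x).
Proof.
have [P [f [tf _ fS]]] := witt_lift B; have [y <-] := fS x.
rewrite witt_mapE -witt_map_teich -witt_map_shift -witt_map_V -rmorphD.
congr (witt_map W f _); apply: ghost_inj => // -[|n].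
  by rewrite wghostD wghost_V0 addr0 wghost_teich /wghost ghost0E expn0 expr1.
rewrite wghostD wghost_VS wghost_teich /wghost ghostSl; congr (_ + _ * _).
by apply: eq_bigr => i _; rewrite witt_of_seqK.
Qed.

Lemma witt_coord0_eq0 x : witt_coord x 0 = 0 -> x = witt_V (witt_shift x).
Proof.
move=> x0; apply: witt_ext => -[|n]; rewrite witt_of_seqK //.
by rewrite witt_of_seqK.
Qed.

Lemma teich0 : teich 0 = 0 :> W B.
Proof.
have [P [f [tf _ fS]]] := witt_lift B.
rewrite -(rmorph0 f) -witt_map_teich -[RHS](rmorph0 (witt_map W f)); congr (witt_map W f _).
apply: ghost_inj => // n; rewrite wghost_teich expr0n expn_eq0 -leqn0 leqNgt (ltnW q_gt1) /=.
by rewrite -[X in wghost X n](subrr 0) wghostB subrr.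
Qed.

Lemma coord_zero n : witt_coord (0 : W B) n = 0.
Proof. by rewrite -teich0 witt_of_seqK; case: n. Qed.

Lemma iterVB n x y : iter n witt_V (x - y) = iter n witt_V x - iter n witt_V y.
Proof. by elim: n => //= n ->; rewrite witt_VB. Qed.

HB.instance Definition _ n := GRing.isZmodMorphism.Build (W B) (W B) (iter n witt_V) (iterVB n).

Lemma iterVD n x y : iter n witt_V (x + y) = iter n witt_V x + iter n witt_V y.
Proof. exact: (raddfD (iter n witt_V)). Qed.

Lemma iterV0 n : iter n witt_V (0 : W B) = 0.
Proof. exact: (raddf0 (iter n witt_V)). Qed.

Lemma iterVZ n r x : iter n witt_V (alg_map (W B) r * x) = alg_map (W B) r * iter n witt_V x.
Proof. by elim: n => //= n ->; rewrite witt_VZ. Qed.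

Lemma iterV_inj n : injective (iter n (@witt_V B)).
Proof. by elim: n => //= n IHn x y /witt_V_inj/IHn. Qed.

(** Truncation to N coordinates is reduction modulo the subgroup V^N W; this makes it compatible
    with addition. The induction strips the common Teichmueller term by [witt_decomp] and divides
    the rest by V. *)
Lemma witt_coord_congr N x y :
  (forall i, (i < N)%N -> witt_coord x i = witt_coord y i) <->
  exists z, x = y + iter N witt_V z.
Proof.
elim: N x y => [|N IHN] x y.
  by split=> // _; exists (x - y); rewrite /= addrC subrK.
have shiftE (z : W B) i : witt_coord (witt_shift z) i = witt_coord z i.+1.
  by rewrite witt_of_seqK.
split=> [xy|[z xE]].
  have /IHN[z zE] : forall i, (i < N)%N ->
      witt_coord (witt_shift x) i = witt_coord (witt_shift y) i.
    by move=> i iN; rewrite !shiftE xy.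
  exists z; rewrite (witt_decomp x) (witt_decomp y) xy // zE /= -addrA; congr (_ + _).
  exact: raddfD.
have x0 : witt_coord x 0 = witt_coord y 0 by rewrite xE coord0D coord0_V addr0.
suff /IHN H : exists z, witt_shift x = witt_shift y + iter N witt_V z.
  by move=> [|i] // iN; rewrite -!shiftE H.
exists z; apply: witt_V_inj; rewrite raddfD; apply: (addrI (teich (witt_coord x 0))).
by rewrite -witt_decomp x0 addrA -witt_decomp.
Qed.

Lemma witt_limit (s : nat -> W B) :
    (forall n, exists z, s n.+1 = s n + iter n witt_V z) ->
  exists x, forall n, exists z, x = s n + iter n witt_V z.
Proof.
(* Coordinate n is read off [s n.+1]: all later corrections lie in V^(n+1) W and leave it
   unchanged. *)
move=> sS; exists (witt_of_seq (fun n => witt_coord (s n.+1) n)) => n.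
apply/witt_coord_congr => i i_n; rewrite witt_of_seqK.
elim: n i_n => // n IHn; rewrite ltnS leq_eqVlt => /orP[/eqP-> //|i_n].
by rewrite IHn //; apply/esym; move: i i_n {IHn}; apply/witt_coord_congr.
Qed.

Lemma witt_separated x y :
  (forall n, exists z, x = y + iter n witt_V z) -> x = y.
Proof.
by move=> xy; apply: witt_ext => n; have /witt_coord_congr := xy n.+1; apply.
Qed.
End Identities.

Section SpecialFiber.
Variable B : algebra O.
Hypothesis pi0 : alg_map B pi = 0.

(* Over a torsion-free lift, [alg_map pi * teich c - V (teich (c ^+ q))] has
   ghost vector [(pi c, 0, 0, ...)], hence coordinates divisible by [pi]. *)
Lemma uniformizer_teich (c : B) :
  alg_map (W B) pi * teich c = witt_V (teich (c ^+ q)).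
Proof.
have [P [f [tf fS _]]] := witt_lift B; have [{}c <-] := fS c.
rewrite -rmorphXn -!witt_map_teich -witt_map_V -(alg_funE (witt_map W f)) -rmorphM.
apply/eqP; rewrite -subr_eq0 -rmorphB; apply/eqP; set z := _ - _.
have z0 : wghost z 0 = alg_map P pi * c.
  by rewrite wghostB wghostM wghost_V0 wghostC wghost_teich subr0 expn0 expr1.
have zS n : wghost z n.+1 = 0.
  by rewrite wghostB wghostM wghost_VS wghostC !wghost_teich -exprM -expnS subrr.
have zE n : exists t, witt_coord z n = alg_map P pi * t.
  have [m] := ubnP n; elim: m n => // m IHm [|n]; rewrite ltnS => nm.
    by exists c; rewrite -z0 /wghost ghost0E.
  have /choice[t tE] i : exists t, (i <= n)%N -> witt_coord z i = alg_map P pi * t.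
    case: (leqP i n) => [i_n|_]; last by exists 0.
    by have [|t tE] := IHm i; [rewrite (leq_ltn_trans i_n)|exists t].
  (* Vanishing of ghost component n+1 writes pi^(n+1) z_(n+1) as minus the sum of the pi^i
     z_i^(q^(n+1-i)). As [pi] divides each z_i, such a term is divisible by pi^(i + q^(n+1-i)), and
     q^m > m leaves a spare factor [pi] beyond pi^(n+1). *)
  have k_ge (i : 'I_n.+1) : (n.+2 <= i + q ^ (n.+1 - i))%N.
    have := ltn_expl (n.+1 - i) q_gt1.
    by rewrite -(ltn_add2l i) subnKC // ltnW.
  pose s := \sum_(i < n.+1) alg_map P (pi ^+ (i + q ^ (n.+1 - i) - n.+2)) * t i ^+ (q ^ (n.+1 - i)).
  exists (- s); apply/eqP; rewrite -subr_eq0; apply/eqP.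
  apply: (torsion_freeX (n := n.+1) tf); have := zS n.
  rewrite /wghost ghostE => <-; rewrite mulrBr !mulrN opprK addrC; congr (_ + _).
  rewrite mulrA -rmorphM -exprSr mulr_sumr; apply: eq_bigr => i _.
  rewrite tE ?leq_ord // exprMn mulrA -rmorphXn -rmorphM -exprD.
  by rewrite mulrA -rmorphM -exprD subnKC.
apply: witt_ext => n; rewrite witt_mapE coord_zero; have [t ->] := zE n.
by rewrite rmorphM alg_funE pi0 mul0r.
Qed.

Lemma uniformizer_iterV n k (c : B) :
  alg_map (W B) (pi ^+ k) * iter n witt_V (teich c) =
  iter (n + k) witt_V (teich (c ^+ (q ^ k))).
Proof.
elim: k n c => [|k IHk] n c; first by rewrite expr0 rmorph1 mul1r addn0 expn0 expr1.
rewrite exprSr rmorphM -mulrA -iterVZ uniformizer_teich -iterSr IHk addSnnS.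
by rewrite -exprM expnS.
Qed.

(** Coordinate 0 of a product is the product of the coordinates 0, so multiplication by [pi] maps W
    into V W when [pi] vanishes in the algebra. This controls remainders, for which no explicit
    formula is wanted. *)
Lemma uniformizer_iterV_ex n k (x : W B) :
  exists z, alg_map (W B) (pi ^+ k) * iter n witt_V x = iter (n + k) witt_V z.
Proof.
elim: k n x => [|k IHk] n x; first by exists x; rewrite expr0 rmorph1 mul1r addn0.
rewrite exprSr rmorphM -mulrA -iterVZ; have : witt_coord (alg_map (W B) pi * x) 0 = 0.
  by rewrite coord0M coord0C pi0 mul0r.
by move/witt_coord0_eq0 ->; rewrite -iterSr -addSnnS.
Qed.
End SpecialFiber.
End WittTheory.

(** * Totally ramified extensions *)

Section DvrTheory.
Variables (O : idomainType) (pi : O).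
Hypotheses (O_dvr : is_dvr O) (pi_unif : is_uniformizer pi).

Lemma uniformizer_nonunit : pi \isn't a GRing.unit.
Proof. by apply/pi_unif; exists 1; rewrite mul1r. Qed.

Lemma uniformizer_neq0 : pi != 0.
Proof.
have [_ _ [x [x0 /pi_unif[c xE]]]] := O_dvr.
by apply: contraNneq x0 => p0; rewrite xE p0 mulr0.
Qed.

(** The intersection of the powers of (pi) is principal, say (b). Writing b = c pi, the factor c
    lies in the intersection too, so c = d b; if b were nonzero, d would be an inverse of [pi]. *)
Lemma uniformizer_separated a : (forall n, exists c, a = c * pi ^+ n) -> a = 0.
Proof.
have [PID _ _] := O_dvr.
have [|b bP] := PID (fun x => forall n, exists c, x = c * pi ^+ n).
  split=> [n|x y xP yP n|c x xP n]; first by exists 0; rewrite mul0r.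
    by have [c ->] := xP n; have [d ->] := yP n; exists (c + d); rewrite mulrDl.
  by have [d ->] := xP n; exists (c * d); rewrite mulrA.
have bI : forall n, exists c, b = c * pi ^+ n by apply/bP; exists 1; rewrite mul1r.
have [c bE] := bI 1%N.
have [d cE] : exists d, c = d * b.
  apply/bP => n; have [d bE'] := bI n.+1.
  exists d; apply: (mulIf uniformizer_neq0).
  by rewrite -mulrA -exprSr -bE' bE expr1.
suff b0 : b = 0 by move=> aP; have [f ->] := (bP a).1 aP; rewrite b0 mulr0.
apply/eqP; apply: contraNT uniformizer_nonunit => b0.
apply/unitrP; exists d; rewrite [pi * d]mulrC; suff : d * pi = 1 by [].
by apply: (mulIf b0); rewrite mul1r -mulrA [pi * b]mulrC mulrA -cE -[pi]expr1 -bE.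
Qed.

Lemma dvr_factor a : a != 0 -> exists w n, w \is a GRing.unit /\ a = w * pi ^+ n.
Proof.
move=> a0; have /existsNP[n] : ~ (forall n, exists c, a = c * pi ^+ n).
  by move/uniformizer_separated => aE; rewrite aE eqxx in a0.
elim: n a {a0} => [|n IHn] a.
  by case; exists a; rewrite mulr1.
move=> Na; have [ua|/pi_unif[c aE]] := boolP (a \is a GRing.unit).
  by exists a, 0%N; rewrite mulr1.
have [|w [k [uw cE]]] := IHn c.
  by move=> [d cE]; apply: Na; exists d; rewrite aE cE exprSr mulrA.
by exists w, k.+1; rewrite aE cE exprSr mulrA.
Qed.
End DvrTheory.

Section PowerBasis.
Variables (O O' : idomainType) (iota : {rmorphism O -> O'}) (pi : O) (varpi v : O') (e : nat).
Hypotheses (O_dvr : is_dvr O) (pi_unif : is_uniformizer pi).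
Hypothesis O_complete : adically_complete pi.
Hypothesis varpi_unif : is_uniformizer varpi.
Hypotheses (v_unit : v \is a GRing.unit) (piE : iota pi = v * varpi ^+ e).
Hypothesis iota_inj : injective iota.
Hypothesis iota_res : forall x, exists a y, x = iota a + y * varpi.
Hypothesis e_gt0 : (0 < e)%N.
Hypothesis O'_int : forall x, exists2 p : {poly O}, p != 0 & root (map_poly iota p) x.

(** Take an algebraic equation of x over O. Its constant term is a multiple of x, hence of every
    power of iota(pi), and so must vanish; dividing the equation by x lowers the degree. *)
Lemma iota_separated x : (forall n, exists c, x = c * iota pi ^+ n) -> x = 0.
Proof.
move=> xP; have [p] := O'_int x; elim/poly_ind: p => [|p c IHp]; first by rewrite eqxx.
rewrite rmorphD rmorphM /= map_polyX map_polyC rootE !hornerE => pc0 /eqP pcx.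
have c0 : c = 0.
  apply/eqP; apply: contraT => /(dvr_factor O_dvr pi_unif)[w [k [uw cE]]].
  (* One power more than the valuation k of c, so that the unit iota(w) would be a multiple of
     iota(pi). *)
  have [d dE] := xP k.+1; move: pcx; set y := (map_poly _ _).[x] => pcx.
  have : iota w * iota pi ^+ k = - (y * d * iota pi) * iota pi ^+ k.
    rewrite mulNr -!mulrA -exprS -dE -rmorphXn -rmorphM -cE.
    by apply/eqP; rewrite -addr_eq0 addrC pcx.
  move/mulIf; rewrite -rmorphXn (raddf_eq0 _ iota_inj) expf_eq0.
  rewrite (negbTE (uniformizer_neq0 O_dvr pi_unif)) andbF => /(_ isT) wE.
  have : iota w \is a GRing.unit by exact: rmorph_unit.
  rewrite wE; apply: contraTT => _; apply/varpi_unif; rewrite piE.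
  by exists (- (y * d * (v * varpi ^+ e.-1))); rewrite mulNr -!mulrA -exprSr prednK.
move: pcx; rewrite c0 raddf0 addr0 => /eqP; rewrite mulf_eq0 => /orP[px|/eqP //].
by apply: IHp => //; apply: contraNneq pc0 => ->; rewrite c0 mul0r addr0.
Qed.

(** A comparison of valuations. If a_k is divisible by [pi] for all k < i, those terms are divisible
    by varpi^(e+k), where e + k > i; the terms with k > i are divisible by varpi^(i+1) anyway. Hence
    [varpi] divides iota(a_i), and a_i is not a unit. *)
Lemma power_basis_divides (a : 'I_e -> O) :
  \sum_(i < e) iota (a i) * varpi ^+ i = 0 -> forall i, exists b, a i = b * pi.
Proof.
move=> s0 i; apply/pi_unif; have [m] := ubnP (i : nat); elim: m i => // m IHm i.
rewrite ltnS => im.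
have /choice[c cE] k : exists c, k != i -> iota (a k) * varpi ^+ k = c * varpi ^+ i.+1.
  have [ki|ik|/val_inj ki] := ltngtP (k : nat) i; last 1 first.
  - by exists 0; rewrite ki eqxx.
  - have /pi_unif[b ->] := IHm k (leq_trans ki im).
    exists (iota b * v * varpi ^+ (e + k - i.+1)) => _.
    rewrite -mulrA -exprD subnK; last by rewrite (leq_trans (ltn_ord i)) ?leq_addr.
    by rewrite rmorphM piE exprD !mulrA.
  - by exists (iota (a k) * varpi ^+ (k - i.+1)) => _; rewrite -mulrA -exprD subnK.
move: s0; rewrite (bigD1 i) //= (eq_bigr (fun k => c k * varpi ^+ i.+1)) //.
rewrite -mulr_suml exprS mulrA -mulrDl => /eqP; rewrite mulf_eq0 expf_eq0.
have varpi0 : varpi != 0.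
  apply: contraTneq (uniformizer_neq0 O_dvr pi_unif) => varpi0; rewrite negbK.
  have : iota pi = 0 by rewrite piE varpi0 expr0n gtn_eqF // mulr0.
  by rewrite -[RHS](rmorph0 iota) => /iota_inj ->.
rewrite (negbTE varpi0) andbF orbF addr_eq0 => /eqP ai.
apply/negP => /(rmorph_unit iota); apply/negP; apply/varpi_unif; rewrite ai.
by eexists; rewrite -mulNr.
Qed.

(** Infinite descent: by [power_basis_divides] a relation can be divided by [pi], so its
    coefficients lie in every power of (pi). *)
Lemma power_basis_free (a : 'I_e -> O) :
  \sum_(i < e) iota (a i) * varpi ^+ i = 0 -> forall i, a i = 0.
Proof.
move=> s0 i; apply: (uniformizer_separated O_dvr pi_unif) => n.
elim: n a s0 => [|n IHn] a s0; first by exists (a i); rewrite mulr1.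
have [b bE] := choice (power_basis_divides s0).
have [|c cE] := IHn b; last by exists c; rewrite bE cE exprSr mulrA.
apply/eqP; have : iota pi != 0.
  by rewrite (raddf_eq0 _ iota_inj) (uniformizer_neq0 O_dvr pi_unif).
move/mulfI => inj; apply/eqP; apply: inj; rewrite mulr0 -[RHS]s0 mulr_sumr.
by apply: eq_bigr => k _; rewrite bE rmorphM mulrCA mulrA.
Qed.

(** Expand x in digits of O along powers of [varpi] and regroup them in blocks of length e: this
    gives approximations modulo iota(pi)^n with coefficients in O. The coefficients converge in O,
    and [iota_separated] identifies the limit with x. *)
Lemma power_basis_generates x : exists a : 'I_e -> O, x = \sum_(i < e) iota (a i) * varpi ^+ i.
Proof.
have [digit /choice[tail tailE]] := choice iota_res.
have expand m y :
    y = \sum_(i < m) iota (digit (iter i tail y)) * varpi ^+ i + iter m tail y * varpi ^+ m.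
  elim: m => [|m IHm]; first by rewrite big_ord0 add0r mulr1.
  by rewrite big_ord_recr /= -addrA exprS mulrA -mulrDl -tailE.
(* The tail after e digits is multiplied by varpi^e = v^-1 iota(pi); absorbing v^-1 turns blocks of
   e digits into powers of iota(pi). *)
pose next y := iter e tail y * v^-1.
have nextE y : y = \sum_(i < e) iota (digit (iter i tail y)) * varpi ^+ i + next y * iota pi.
  by rewrite {1}(expand e y) /next piE mulrA mulrVK.
pose s (i : 'I_e) n := \sum_(k < n) digit (iter i tail (iter k next x)) * pi ^+ k.
have sE n : x = \sum_(i < e) iota (s i n) * varpi ^+ i + iter n next x * iota pi ^+ n.
  elim: n => [|n IHn].
    rewrite big1 ?add0r ?mulr1 // => i _.
    by rewrite /s big_ord0 rmorph0 mul0r.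
  rewrite {1}IHn {1}[iter n next x]nextE mulrDl addrA -mulrA -exprS; congr (_ + _).
  rewrite mulr_suml -big_split /=; apply: eq_bigr => i _.
  by rewrite /s big_ord_recr /= rmorphD mulrDl rmorphM rmorphXn mulrAC.
have s_cauchy i n m : (n <= m)%N -> exists c, s i m - s i n = c * pi ^+ n.
  move=> /subnKC <-; exists (\sum_(k < m - n) digit (iter i tail (iter (n + k) next x)) * pi ^+ k).
  rewrite /s big_split_ord /= addrAC subrr add0r mulr_suml; apply: eq_bigr => k _.
  by rewrite -mulrA -exprD addnC.
have /choice[l lE] i : exists l, forall n, exists N, forall m, (N <= m)%N ->
    exists c, s i m - l = c * pi ^+ n.
  apply: O_complete => n; exists n => m m' nm nm'.
  have [c cE] := s_cauchy i n m nm; have [c' cE'] := s_cauchy i n m' nm'.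
  by exists (c - c'); rewrite mulrBl -cE -cE' opprB addrA subrK.
exists l; apply/eqP; rewrite -subr_eq0; apply/eqP; apply: iota_separated => n.
have /choice[N NE] := (fun i => lE i n).
(* An index beyond all the thresholds N_i and at least n. *)
pose m := (n + \sum_(i < e) N i)%N.
have /choice[c cE] i : exists c, s i m - l i = c * pi ^+ n.
  by apply: NE; rewrite /m (bigD1 i) //= addnCA leq_addr.
exists (\sum_(i < e) iota (c i) * varpi ^+ i + iter m next x * iota pi ^+ (m - n)).
rewrite {1}(sE m) addrAC -sumrB mulrDl -mulrA -exprD subnK ?leq_addr //.
congr (_ + _); rewrite mulr_suml; apply: eq_bigr => i _.
by rewrite -mulrBl -rmorphB cE rmorphM rmorphXn mulrAC.
Qed.
End PowerBasis.

(** * Tensor products with a finite free algebra *)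

Record free_basis (O O' : comPzRingType) (iota : {rmorphism O -> O'}) (e : nat) := FreeBasis {
  basis_fun :> 'I_e -> O';
  basis_coord : O' -> 'I_e -> O;
  basis_coordE : forall s, s = \sum_(i < e) iota (basis_coord s i) * basis_fun i;
  basis_free : forall c : 'I_e -> O,
    \sum_(i < e) iota (c i) * basis_fun i = 0 -> forall i, c i = 0 }.

Section FreeTensor.
Variables (O O' : comPzRingType) (iota : {rmorphism O -> O'}) (e : nat).
Variables (b : free_basis iota e) (A : comPzRingType) (f : {rmorphism O -> A}).

Lemma basis_coord_uniq s c : s = \sum_(i < e) iota (c i) * b i -> basis_coord b s =1 c.
Proof.
move=> sE i; apply/eqP; rewrite -subr_eq0; apply/eqP; move: i.
apply: (@basis_free _ _ _ _ b); under eq_bigr => i _ do rewrite rmorphB mulrBl.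
by rewrite sumrB -sE -basis_coordE subrr.
Qed.

Lemma basis_coordB s t i : basis_coord b (s - t) i = basis_coord b s i - basis_coord b t i.
Proof.
move: i; apply: basis_coord_uniq; rewrite {1}(basis_coordE b s) {1}(basis_coordE b t) -sumrB.
by apply: eq_bigr => i _; rewrite rmorphB mulrBl.
Qed.

Lemma basis_coordZ r s i : basis_coord b (iota r * s) i = r * basis_coord b s i.
Proof.
move: i; apply: basis_coord_uniq; rewrite {1}(basis_coordE b s) mulr_sumr.
by apply: eq_bigr => i _; rewrite rmorphM mulrA.
Qed.

Lemma basis_coord_basis i j : basis_coord b (b i) j = (i == j)%:R.
Proof.
move: j; apply: basis_coord_uniq; rewrite (bigD1 i) //= eqxx rmorph1 mul1r big1 ?addr0 //.
by move=> j /negbTE ji; rewrite eq_sym ji rmorph0 mul0r.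
Qed.

(** A concrete model of the tensor product of A and O' over O. Mapping an arbitrary tensor product
    to it proves that coordinates along the basis are unique. *)
Definition free_tensor : Type := {ffun 'I_e -> A}.
HB.instance Definition _ := GRing.Zmodule.copy free_tensor {ffun 'I_e -> A}.

Definition pure (a : A) (s : O') : free_tensor := [ffun i => a * f (basis_coord b s i)].

Lemma pureBl s : {morph pure^~ s : a a' / a - a'}.
Proof. by move=> a a'; apply/ffunP => i; rewrite !ffunE mulrBl. Qed.

Lemma pureBr a : {morph pure a : s s' / s - s'}.
Proof. by move=> s s'; apply/ffunP => i; rewrite !ffunE basis_coordB rmorphB mulrBr. Qed.

HB.instance Definition _ a := GRing.isZmodMorphism.Build O' free_tensor (pure a) (pureBr a).

Lemma pureDl s : {morph pure^~ s : a a' / a + a'}.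
Proof. by move=> a a'; apply/ffunP => i; rewrite !ffunE mulrDl. Qed.

Lemma pureZ a r s : pure (a * f r) s = pure a (iota r * s).
Proof. by apply/ffunP => i; rewrite !ffunE basis_coordZ rmorphM mulrA. Qed.

Lemma pure_expand (x : free_tensor) : x = \sum_i pure (x i) (b i).
Proof.
apply/ffunP => i; rewrite sum_ffunE (bigD1 i) //= ffunE basis_coord_basis eqxx.
rewrite rmorph1 mulr1 big1 ?addr0 // => j /negbTE ji.
by rewrite ffunE basis_coord_basis ji rmorph0 mulr0.
Qed.

(** The bilinear extension of the product of pure tensors. By [pure_expand] the ring laws need
    checking on pure tensors only, where [pureM] applies. *)
Definition ft_mul (x y : free_tensor) : free_tensor :=
  \sum_i \sum_j pure (x i * y j) (b i * b j).

Lemma ft_mulC : commutative ft_mul.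
Proof.
move=> x y; rewrite /ft_mul exchange_big /=; apply: eq_bigr => i _.
by apply: eq_bigr => j _; rewrite mulrC [b i * _]mulrC.
Qed.

Lemma ft_mulDl : left_distributive ft_mul +%R.
Proof.
move=> x y z; rewrite /ft_mul -big_split /=; apply: eq_bigr => i _.
rewrite -big_split /=; apply: eq_bigr => j _; rewrite ffunE mulrDl.
exact: pureDl.
Qed.

Lemma ft_mul0 x : ft_mul 0 x = 0.
Proof. by apply: (addrI (ft_mul 0 x)); rewrite -ft_mulDl !addr0. Qed.

Lemma ft_mul_suml (x : 'I_e -> free_tensor) y :
  ft_mul (\sum_i x i) y = \sum_i ft_mul (x i) y.
Proof.
by apply: (big_morph (ft_mul^~ y)) => [u v|]; [exact: ft_mulDl|exact: ft_mul0].
Qed.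

Lemma ft_mul_sumr (x : 'I_e -> free_tensor) y :
  ft_mul y (\sum_i x i) = \sum_i ft_mul y (x i).
Proof. by rewrite ft_mulC ft_mul_suml; apply: eq_bigr => i _; rewrite ft_mulC. Qed.

Lemma pureM a a' s s' : ft_mul (pure a s) (pure a' s') = pure (a * a') (s * s').
Proof.
rewrite {2}(basis_coordE b s) mulr_suml raddf_sum; apply: eq_bigr => i _.
rewrite {2}(basis_coordE b s') mulr_sumr raddf_sum; apply: eq_bigr => j _.
by rewrite !ffunE mulrACA -rmorphM pureZ rmorphM mulrACA.
Qed.

Lemma ft_mulA : associative ft_mul.
Proof.
move=> x y z; rewrite (pure_expand x) !ft_mul_suml; apply: eq_bigr => i _.
rewrite (pure_expand y) !(ft_mul_suml, ft_mul_sumr); apply: eq_bigr => j _.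
rewrite (pure_expand z) !ft_mul_sumr; apply: eq_bigr => k _.
by rewrite !pureM !mulrA.
Qed.

Lemma ft_mul1 : left_id (pure 1 1) ft_mul.
Proof.
move=> x; rewrite (pure_expand x) ft_mul_sumr; apply: eq_bigr => i _.
by rewrite pureM !mul1r.
Qed.

HB.instance Definition _ := GRing.Zmodule_isComPzRing.Build free_tensor
  ft_mulA ft_mulC ft_mul1 ft_mulDl.

Definition ft_l (a : A) : free_tensor := pure a 1.
Definition ft_r (s : O') : free_tensor := pure 1 s.

Fact ft_l_zmod : zmod_morphism ft_l. Proof. by move=> a a'; exact: pureBl. Qed.
Fact ft_l_monoid : monoid_morphism ft_l.
Proof. by split=> // a a'; rewrite /ft_l -[1 in LHS]mul1r -pureM. Qed.
HB.instance Definition _ := GRing.isZmodMorphism.Build A free_tensor ft_l ft_l_zmod.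
HB.instance Definition _ := GRing.isMonoidMorphism.Build A free_tensor ft_l ft_l_monoid.

Fact ft_r_zmod : zmod_morphism ft_r. Proof. by move=> s s'; exact: pureBr. Qed.
Fact ft_r_monoid : monoid_morphism ft_r.
Proof. by split=> // s s'; rewrite /ft_r -[1 in LHS]mul1r -pureM. Qed.
HB.instance Definition _ := GRing.isZmodMorphism.Build O' free_tensor ft_r ft_r_zmod.
HB.instance Definition _ := GRing.isMonoidMorphism.Build O' free_tensor ft_r ft_r_monoid.

Lemma ft_comm r : ft_l (f r) = ft_r (iota r).
Proof. by rewrite /ft_l -[f r]mul1r pureZ mulr1. Qed.

Variable T : tensor f iota.

Definition tens_sum (x : 'I_e -> A) : T := \sum_i tens_l T (x i) * tens_r T (b i).

Lemma tens_sum_inj x y : tens_sum x = tens_sum y -> x =1 y.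
Proof.
pose h := tens_copair T (h := ft_l) (k := ft_r) ft_comm.
have hE z : h (tens_sum z) = [ffun i => z i].
  rewrite [RHS]pure_expand rmorph_sum; apply: eq_bigr => i _.
  rewrite rmorphM /h tens_copair_l tens_copair_r ffunE.
  by rewrite [LHS]pureM mulr1 mul1r.
by move=> /(congr1 h); rewrite !hE => /ffunP xy i; have := xy i; rewrite !ffunE.
Qed.

Lemma tens_sumB x y : tens_sum x - tens_sum y = tens_sum (fun i => x i - y i).
Proof. by rewrite /tens_sum -sumrB; apply: eq_bigr => i _; rewrite rmorphB mulrBl. Qed.

Lemma tens_sum_pure a s : tens_l T a * tens_r T s = tens_sum (fun i => a * f (basis_coord b s i)).
Proof.
rewrite {1}(basis_coordE b s) rmorph_sum mulr_sumr; apply: eq_bigr => i _.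
by rewrite rmorphM -tens_comm rmorphM mulrA.
Qed.

(** The elements of this form contain both factors and are closed under differences and products, so
    [tensor_ind] applies. *)
Lemma tens_sum_surj t : exists x, t = tens_sum x.
Proof.
pose S t := exists x, t = tens_sum x.
have SD t1 t2 : S t1 -> S t2 -> S (t1 + t2).
  move=> [x ->] [y ->]; exists (fun i => x i + y i).
  by rewrite /tens_sum -big_split; apply: eq_bigr => i _; rewrite rmorphD mulrDl.
have S0 : S 0.
  by exists (fun=> 0); rewrite /tens_sum big1 // => i _; rewrite rmorph0 mul0r.
have Sp a s : S (tens_l T a * tens_r T s) by rewrite tens_sum_pure; eexists.
move: t; apply: tensor_ind.
- by move=> a; have := Sp a 1; rewrite rmorph1 mulr1.
- by move=> s; have := Sp 1 s; rewrite rmorph1 mul1r.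
- by move=> _ _ [x ->] [y ->]; rewrite tens_sumB; eexists.
- move=> _ _ [x ->] [y ->]; rewrite {1}/tens_sum mulr_suml.
  apply: (big_ind S) => // i _; rewrite /tens_sum mulr_sumr.
  by apply: (big_ind S) => // j _; rewrite mulrACA -!rmorphM; exact: Sp.
Qed.
End FreeTensor.

(** * Witt vector expansions *)

Section PairIndex.
Variables (e : nat) (e_gt0 : (0 < e)%N).

Definition pair_of_index (m : nat) : nat * 'I_e :=
  ((m %/ e)%N, Ordinal (ltn_pmod m e_gt0)).

Lemma pair_of_indexE n (i : 'I_e) : pair_of_index (n * e + i) = (n, i).
Proof.
rewrite /pair_of_index divnMDl // divn_small // addn0; congr (_, _).
by apply: val_inj; rewrite /= modnMDl modn_small.
Qed.

Lemma sum_pair_of_index (V : nmodType) (F : nat -> V) N :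
  \sum_(m < N * e) F m = \sum_(n < N) \sum_(i < e) F (n * e + i)%N.
Proof.
elim: N => [|N IHN]; first by rewrite mul0n !big_ord0.
by rewrite big_ord_recr -IHN mulSnr big_split_ord.
Qed.
End PairIndex.

Section Expansion.
Variables (O : idomainType) (pi v : O) (q : nat) (W : witt pi q) (e : nat).
Hypotheses (pi_neq0 : pi != 0) (q_gt1 : (1 < q)%N).
Hypotheses (v_unit : v \is a GRing.unit) (e_gt0 : (0 < e)%N).
Let idx := pair_of_index e_gt0.

Section Digits.
Variable B : algebra O.
Local Notation V := (@witt_V O pi q W B).
Local Notation al := (alg_map (W B)).
Implicit Types (x : W B) (y : nat * 'I_e -> B).

Definition digit y m : W B := al (v ^+ (idx m).1) * iter m V (teich W (y (idx m))).

Definition psum y N : W B := \sum_(m < N) digit y m.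

(* [x] is the sum of the [v ^ (m / e) V^m [y_m]], where [y] is indexed by the
   quotient and the remainder of [m] by [e]. *)
Definition expansion x y := forall N, exists z, x = psum y N + iter N V z.

Let VD n x x' : iter n V (x + x') = iter n V x + iter n V x'.
Proof. exact: iterVD. Qed.

Let V0 n : iter n V 0 = 0.
Proof. exact: iterV0. Qed.

Lemma digitE y m : digit y m = iter m V (al (v ^+ (idx m).1) * teich W (y (idx m))).
Proof. by rewrite iterVZ. Qed.

Lemma psumS y N : psum y N.+1 = psum y N + digit y N.
Proof. by rewrite /psum big_ord_recr. Qed.

Lemma psum_tail y N M : (N <= M)%N -> exists z, psum y M = psum y N + iter N V z.
Proof.
move=> /subnKC <-; elim: (M - N)%N => [|k [z zE]].
  by exists 0; rewrite V0 addr0 addn0.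
exists (z + iter k V (al (v ^+ (idx (N + k)).1) * teich W (y (idx (N + k))))).
by rewrite addnS psumS zE digitE VD addrA -iterD.
Qed.

(** Lets an expansion be checked on whole blocks of e digits, the form in which the values of u_ra
    arise. *)
Lemma expansion_cofinal x y :
  (forall N, exists z, x = psum y (N * e) + iter (N * e) V z) -> expansion x y.
Proof.
move=> xy N; have [z ->] := xy N.
have le : (N <= N * e)%N by rewrite leq_pmulr.
have [w ->] := psum_tail y le; exists (w + iter (N * e - N) V z).
by rewrite VD -iterD subnKC // addrA.
Qed.

Lemma expansion_sum y : exists x, expansion x y.
Proof.
apply: (witt_limit pi_neq0 q_gt1) => n; exists (al (v ^+ (idx n).1) * teich W (y (idx n))).
by rewrite psumS digitE.
Qed.

Lemma expansion_inj x x' y : expansion x y -> expansion x' y -> x = x'.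
Proof.
move=> xy x'y; apply: (witt_separated pi_neq0 q_gt1) => N.
have [z ->] := xy N; have [z' ->] := x'y N.
by exists (z - z'); rewrite -addrA -VD [z' + _]addrC subrK.
Qed.

Let vK k c : alg_map B (v ^+ k) * (alg_map B (v^-1 ^+ k) * c) = c.
Proof. by rewrite mulrA -rmorphM -exprMn mulrV // expr1n rmorph1 mul1r. Qed.

Lemma expansion_digits x : exists y, expansion x y.
Proof.
(* One division step: as [v] is a unit, the digit c = v^-n x_0 makes x - v^n [c] vanish in
   coordinate 0, hence lie in V W. *)
have /choice[Y /choice[Z YZ]] (p : nat * W B) : exists (c : B) z,
    p.2 = al (v ^+ p.1) * teich W c + V z.
  exists (alg_map B (v^-1 ^+ p.1) * witt_coord p.2 0).
  have /(witt_coord0_eq0) E : witt_coord (p.2 - al (v ^+ p.1) *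
      teich W (alg_map B (v^-1 ^+ p.1) * witt_coord p.2 0)) 0 = 0.
    by rewrite coord0B coord0M coord0C coord0_teich vK subrr.
  exists (witt_shift (p.2 - al (v ^+ p.1) *
    teich W (alg_map B (v^-1 ^+ p.1) * witt_coord p.2 0))).
  by rewrite -E addrC subrK.
(* [z m] is the remainder after m digits. The power of [v] in step k is the quotient of k by e. *)
pose fix z m := if m is k.+1 then Z ((idx k).1, z k) else x.
pose y' m := Y ((idx m).1, z m); pose y (p : nat * 'I_e) := y' (p.1 * e + p.2)%N.
have yE m : y (idx m) = y' m by rewrite /y /= -divn_eq.
exists y => N; exists (z N); elim: N => [|N IHN]; first by rewrite /psum big_ord0 add0r.
rewrite psumS digitE -addrA {1}IHN; congr (_ + _).
by rewrite yE iterSr -VD; congr (iter _ _ _); exact: (YZ (_, _)).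
Qed.

(** Once the earlier digits agree, cancel their sum, strip the injective V^m and compare coordinates
    0; these are the digits times the unit v^n. *)
Lemma expansion_uniq x y y' : expansion x y -> expansion x y' -> y =1 y'.
Proof.
move=> xy xy'; suff H m : y (idx m) = y' (idx m).
  by case=> n i; have := H (n * e + i)%N; rewrite /idx pair_of_indexE.
have [N] := ubnP m; elim: N m => // N IHN m; rewrite ltnS => mN.
have [z xE] := xy m.+1; have [z'] := xy' m.+1; rewrite xE !psumS !digitE.
have -> : psum y m = psum y' m.
  by apply: eq_bigr => i _; rewrite /digit IHN // (leq_trans (ltn_ord i)).
rewrite -!addrA => /addrI; rewrite !iterSr -!VD => /(iterV_inj) E.
have := congr1 (fun w : W B => witt_coord w 0) E.
rewrite !coord0D !coord0M !coord0C !coord0_V !coord0_teich !addr0 => E'.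
by rewrite -[LHS](vK (idx m).1) mulrCA E' mulrCA vK.
Qed.

Lemma expansion0 y : expansion 0 y <-> forall p, y p = 0.
Proof.
have e0 : expansion 0 (fun=> 0).
  by move=> N; exists 0; rewrite V0 addr0 /psum big1 // => m _; rewrite digitE teich0 // mulr0 V0.
split=> [/expansion_uniq/(_ e0) //|y0].
by rewrite (_ : y = fun=> 0) //; exact: funext.
Qed.
End Digits.

Lemma expansion_map (B C : algebra O) (f : alg_hom B C) (x : W B) y :
  expansion x y -> expansion (witt_map W f x) (fun p => f (y p)).
Proof.
move=> xy N; have [z ->] := xy N; exists (witt_map W f z).
rewrite rmorphD rmorph_sum witt_map_iterV; congr (_ + _); apply: eq_bigr => m _.
by rewrite rmorphM witt_map_iterV witt_map_teich alg_funE.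
Qed.
End Expansion.

Section DrinfeldExpansion.
Variables (O O' : idomainType) (iota : {rmorphism O -> O'}) (pi : O) (varpi v : O').
Variables (q e : nat) (W : witt pi q) (W' : witt varpi q) (u : drinfeld iota W W').
Hypotheses (pi_neq0 : pi != 0) (varpi_neq0 : varpi != 0) (q_gt1 : (1 < q)%N).
Hypotheses (e_gt0 : (0 < e)%N) (piE : iota pi = v * varpi ^+ e).

(** The lift is taken over O', so that [u] is defined on it. Identities are compared in W', hence
    torsion-freeness for [varpi] is what matters. *)
Lemma drinfeld_lift (B : algebra O') : exists (P : algebra O') (f : alg_hom P B),
  [/\ torsion_free varpi P, forall c, exists p, f p = c &
      forall x, exists y, witt_map W (restr_hom iota f) y = x].
Proof.
have [P [f [tf fS _]]] := witt_lift W' varpi_neq0 B; exists P, f; split=> // x.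
have /choice[y yE] n := fS (witt_coord x n).
exists (witt_of_seq W (B := restr iota P) y); apply: witt_ext => n.
by rewrite witt_mapE witt_of_seqK; exact: yE.
Qed.

Section Values.
Variable B : algebra O'.

Lemma drinfeld_teich (c : B) :
  u B (@teich _ _ _ W (restr iota B) c) = teich W' c :> W' B.
Proof.
have [P [f [tf fS _]]] := drinfeld_lift B; have [p <-] := fS c.
rewrite -(witt_map_teich W' f) -(witt_map_teich W (restr_hom iota f)) dr_nat.
congr (witt_map W' f _); apply: ghost_inj => // n.
by rewrite wghost_teich // [LHS]dr_ghost [LHS]wghost_teich.
Qed.

Lemma drinfeld_V (x : W (restr iota B)) :
  u B (witt_V x) = alg_map (W' B) (v * varpi ^+ e.-1) * witt_V (u B x : W' B) :> W' B.
Proof.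
have [P [f [tf _ fS]]] := drinfeld_lift B; have [y <-] := fS x.
rewrite -witt_map_V !dr_nat -witt_map_V -(alg_funE (witt_map W' f)) -rmorphM.
congr (witt_map W' f _); apply: ghost_inj => // -[|n].
  by rewrite wghostM wghost_V0 mulr0 [LHS]dr_ghost [LHS]wghost_V0.
rewrite wghostM wghost_VS // wghostC [LHS]dr_ghost [LHS]wghost_VS // mulrA -rmorphM.
(* V multiplies ghost components by iota(pi) on W and by [varpi] on W'; the quotient of the two
   factors is v varpi^(e-1). *)
by rewrite -mulrA -exprSr prednK // -piE /wghost dr_ghost.
Qed.
End Values.

Section SpecialFiber.
Variable B : algebra O'.
Hypothesis varpi0 : alg_map B varpi = 0.
Local Notation V := (@witt_V _ _ _ W' B).
Local Notation al := (alg_map (W' B)).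

Let VD n x x' : iter n V (x + x') = iter n V x + iter n V x'.
Proof. exact: iterVD. Qed.

Let Vsum n N (x : 'I_N -> W' B) : iter n V (\sum_i x i) = \sum_i iter n V (x i).
Proof.
apply: big_morph => [x1 x2|]; first exact: VD.
exact: iterV0.
Qed.

(** Induction along x = [x_0] + V(shift x). Each passage of [u] through V costs v varpi^(e-1), and
    varpi^(e-1) turns V^(m+1) [c] into V^(m+e) [c^(q^(e-1))]. *)
Lemma drinfeld_expansion N (x : W (restr iota B)) : exists z : W' B,
  u B x = \sum_(n < N) al (v ^+ n) *
      iter (n * e) V (teich W' ((witt_coord x n : B) ^+ (q ^ (n * e.-1))))
    + iter (N * e) V z :> W' B.
Proof.
elim: N x => [|N IHN] x; first by exists (u B x); rewrite big_ord0 add0r.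
have [z zE] := IHN (witt_shift x).
have [w wE] := uniformizer_iterV_ex varpi_neq0 q_gt1 varpi0 (N * e).+1 e.-1 z.
exists (al v * w); rewrite {1}(witt_decomp pi_neq0 q_gt1 x) rmorphD.
rewrite [X in X + _]drinfeld_teich [X in _ + X]drinfeld_V zE.
rewrite big_ord_recl mul0n !mul0n expr0 rmorph1 mul1r expn0 expr1 -addrA; congr (_ + _).
have -> x' : witt_V x' = iter 1 V x' by [].
rewrite VD -iterD mulrDr; congr (_ + _).
  rewrite Vsum mulr_sumr; apply: eq_bigr => n _.
  rewrite iterVZ // -iterD mulrCA rmorphM -mulrA (uniformizer_iterV W' varpi_neq0 q_gt1 varpi0).
  rewrite !lift0 add1n addSn -addnS prednK // -mulSnr mulrA -rmorphM -exprSr.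
  by rewrite witt_of_seqK -exprM -expnD -mulSnr.
by rewrite add1n rmorphM -mulrA wE addSn -addnS prednK // -mulSnr iterVZ.
Qed.

Variables (b : free_basis iota e) (bE : forall i, b i = varpi ^+ i).
Variable T : forall A : algebra O, tensor (alg_map (W A)) iota.

(** Multiplying the expansion of u(x_i) by varpi^i raises every V-index by i and every digit to the
    power q^i. The V-indices ne + i then run exactly once through the natural numbers. *)
Lemma u_ra_expansion (x : 'I_e -> W (restr iota B)) :
  expansion v e_gt0 (u_ra_map T u B (tens_sum b (T _) x))
    (fun p => (witt_coord (x p.2) p.1 : B) ^+ (q ^ (p.1 * e.-1 + p.2))).
Proof.
apply: expansion_cofinal => // N.
have /choice[z zE] i : exists z, u B (x i) * al (varpi ^+ i) = \sum_(n < N) al (v ^+ n) *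
      iter (n * e + i) V (teich W' ((witt_coord (x i) n : B) ^+ (q ^ (n * e.-1 + i))))
    + iter (N * e) V z :> W' B.
  have [z zE] := drinfeld_expansion N (x i).
  have [w wE] := uniformizer_iterV_ex varpi_neq0 q_gt1 varpi0 (N * e) i z.
  exists (iter i V w); rewrite mulrC zE mulrDr wE iterD; congr (_ + _).
  rewrite mulr_sumr; apply: eq_bigr => n _.
  rewrite mulrCA (uniformizer_iterV W' varpi_neq0 q_gt1 varpi0).
  by rewrite -exprM -expnD.
exists (\sum_i z i); rewrite Vsum /psum (sum_pair_of_index _ (digit _ _ _ _)) exchange_big.
rewrite -big_split rmorph_sum; apply: eq_bigr => i _.
rewrite rmorphM /u_ra_map tens_copair_l tens_copair_r bE [LHS]zE; congr (_ + _).
by apply: eq_bigr => n _; rewrite /digit pair_of_indexE.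
Qed.
End SpecialFiber.
End DrinfeldExpansion.

(** * Universal homeomorphisms *)

Lemma spec_eq (A : comPzRingType) (p p' : spec A) :
  (forall x, spec_ideal p x <-> spec_ideal p' x) -> p = p'.
Proof.
case: p p' => [P Pp] [P' Pp'] /= PP'.
have E : P = P' by apply/funext => x; apply/propext.
by case: _ / E in Pp' PP' *; congr Spec; exact: Prop_irrelevance.
Qed.

Lemma prime_idealX (A : comPzRingType) (p : spec A) x n :
  spec_ideal p (x ^+ n) -> spec_ideal p x.
Proof.
case: p => P [PI P1 PM] /=; elim: n => [/P1 //|n IHn].
by rewrite exprS => /PM[].
Qed.

Lemma ideal_exp (A : comPzRingType) (P : set A) x n :
  is_ideal P -> (0 < n)%N -> P x -> P (x ^+ n).
Proof. by case: n => // n [_ _ PM] _ Px; rewrite exprSr; exact: PM. Qed.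

Lemma ideal_sub (A : comPzRingType) (P : set A) x y :
  is_ideal P -> P x -> P y -> P (x - y).
Proof. by case=> _ PD PM Px Py; rewrite -[y]mul1r -mulNr; exact/PD/PM. Qed.

Section PowerHomeomorphism.
Variables (C D : comPzRingType) (r : {rmorphism C -> D}) (q : nat).
Hypothesis q_gt0 : (0 < q)%N.
Hypothesis frob : forall N (x y : D), (x + y) ^+ (q ^ N) = x ^+ (q ^ N) + y ^+ (q ^ N).
Hypothesis r_power : forall d, exists N c, d ^+ (q ^ N) = r c.
Hypothesis r_nil : forall c, r c = 0 -> exists n, c ^+ n = 0.

Let qN_gt0 N : (0 < q ^ N)%N. Proof. by rewrite expn_gt0 q_gt0. Qed.

Section Contraction.
Variable p : spec C.
Let pI : is_ideal (spec_ideal p). Proof. by case: p => ? []. Qed.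

(** The only candidate for a prime of D over p: a prime contains d as soon as it contains one of its
    powers. *)
Definition root_ideal (d : D) : Prop :=
  exists N c, d ^+ (q ^ N) = r c /\ spec_ideal p c.

Lemma spec_ideal_congr c c' : r c = r c' -> spec_ideal p c -> spec_ideal p c'.
Proof.
have [p0 pD pM] := pI; move=> /eqP; rewrite eq_sym -subr_eq0 -rmorphB => /eqP /r_nil[n nil] pc.
rewrite -[c'](subrK c); apply: pD => //.
by apply: (prime_idealX (n := n)); rewrite nil.
Qed.

(** Membership may be tested on any power of d that comes from C. Two such representatives, raised
    to matching powers, have the same image in D, so they differ by a nilpotent, which lies in p. *)
Lemma root_idealE d N c : d ^+ (q ^ N) = r c -> root_ideal d <-> spec_ideal p c.
Proof.
move=> dE; split=> [[M [c' [dE' pc']]]|pc]; last by exists N, c.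
apply: (prime_idealX (n := q ^ M)); apply: (@spec_ideal_congr (c' ^+ (q ^ N))).
  by rewrite !rmorphXn -dE -dE' -!exprM mulnC.
exact: ideal_exp.
Qed.

Lemma root_ideal_prime : prime_ideal root_ideal.
Proof.
have [p0 pD pM] := pI; split; first split.
- by exists 0%N, 0; rewrite expn0 expr1 rmorph0.
- move=> x y [N [c [xE pc]]] [M [c' [yE pc']]].
  exists (N + M)%N, (c ^+ (q ^ M) + c' ^+ (q ^ N)); split.
    rewrite frob rmorphD !rmorphXn -xE -yE -!exprM -!expnD; congr (_ + _ ^+ (q ^ _)).
    by rewrite addnC.
  by apply: pD; exact: ideal_exp.
- move=> a x [N [c [xE pc]]]; have [M [c' aE]] := r_power a.
  exists (N + M)%N, (c' ^+ (q ^ N) * c ^+ (q ^ M)); split; last by apply: pM; exact: ideal_exp.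
  rewrite exprMn rmorphM !rmorphXn -xE -aE -!exprM -!expnD.
  by congr (_ ^+ (q ^ _) * _); rewrite addnC.
- have /root_idealE -> : 1 ^+ (q ^ 0) = r 1 by rewrite rmorph1 expr1n.
  by case: p => ? [].
- move=> x y; have [N [c xE]] := r_power x; have [M [c' yE]] := r_power y.
  rewrite (root_idealE xE) (root_idealE yE).
  have /root_idealE -> : (x * y) ^+ (q ^ (N + M)) = r (c ^+ (q ^ M) * c' ^+ (q ^ N)).
    rewrite exprMn rmorphM !rmorphXn -xE -yE -!exprM -!expnD; congr (_ * _ ^+ (q ^ _)).
    by rewrite addnC.
  have [_ _ PM] := spec_prime p.
  by move=> /PM[] /prime_idealX; [left|right].
Qed.

Definition root_spec : spec D := Spec root_ideal_prime.
End Contraction.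

Lemma power_homeomorphism : homeomorphism (spec_map r).
Proof.
exists root_spec; split.
- move=> p; apply: spec_eq => d; have [N [c dE]] := r_power d.
  rewrite /= (root_idealE _ dE) /= -dE; split; first exact: prime_idealX.
  by apply: ideal_exp => //; case: p => ? [].
- move=> p; apply: spec_eq => c /=.
  by have /root_idealE -> : r c ^+ (q ^ 0) = r c by rewrite expn0 expr1.
- apply/continuousP => _ [E ->]; exists (r @` E)%classic.
  apply/seteqP; split=> p /= NE H; apply: NE => x.
    by move=> Ex; apply: H; exists x.
  by move=> [y Ey <-]; exact: H.
- apply/continuousP => _ [E ->].
  (* An element of [E] lies in a prime of D exactly when one of its powers does, so the elements of
     C representing such powers cut out the preimage. *)
  exists [set c | exists N d, E d /\ d ^+ (q ^ N) = r c]%classic.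
  apply/seteqP; split=> p /= NE H; apply: NE => x.
    move=> Ex; have [N [c xE]] := r_power x; apply/(root_idealE _ xE).
    by apply: H; exists N, x.
  by move=> [N [d [Ed dE]]]; apply/(root_idealE _ dE); exact: H.
Qed.
End PowerHomeomorphism.

Section PowerMap.
Variable k : finFieldType.
Local Notation q := #|k|.

Lemma finField_exprDn (A : comPzRingType) (f : {rmorphism k -> A}) N (x y : A) :
  (x + y) ^+ (q ^ N) = x ^+ (q ^ N) + y ^+ (q ^ N).
Proof.
have [p p_pr pchark] := finPcharP k; have p0 := pcharf0 pchark.
have {}p0 : p%:R = 0 :> A by rewrite -(rmorph_nat f) p0 rmorph0.
(* The cardinality of k is a power of p, because the additive group of k is an elementary abelian
   p-group. *)
have [n ->] : exists n, (q ^ N = p ^ n)%N.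
  exists (logn p q * N)%N; rewrite expnM; congr (_ ^ _)%N.
  by rewrite -cardsT; exact/card_pgroup/abelem_pgroup/fin_ring_pchar_abelem.
elim: n => [|n IHn]; first by rewrite !expr1.
by rewrite expnSr !exprM IHn exprDn_prime.
Qed.

Variables (I : choiceType) (d : I -> nat).
Local Notation X := (mpoly_alg k I).

Definition power_map : alg_hom X X :=
  mpoly_eval (fun i => (mpoly_var k i : X) ^+ (q ^ d i)).

Lemma power_map_var i : power_map (mpoly_var k i) = (mpoly_var k i : X) ^+ (q ^ d i).
Proof. exact: mpoly_eval_var. Qed.

Section BaseChange.
Variables (C : comPzRingType) (g : {rmorphism X -> C}) (D : tensor power_map g).

(** It suffices to treat generators of the tensor product: constants and elements of C come from C,
    and the variable i does after raising it to the power q^(d i). *)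
Lemma power_map_power (x : D) : exists N c, x ^+ (q ^ N) = tens_r D c.
Proof.
have SD x1 x2 : (exists N c, x1 ^+ (q ^ N) = tens_r D c) ->
    (exists N c, x2 ^+ (q ^ N) = tens_r D c) -> exists N c, (x1 + x2) ^+ (q ^ N) = tens_r D c.
  move=> [N [c cE]] [M [c' cE']]; exists (N + M)%N, (c ^+ (q ^ M) + c' ^+ (q ^ N)).
  rewrite (finField_exprDn (tens_r D \o g \o alg_map X)) rmorphD !rmorphXn -cE -cE'.
  by rewrite -!exprM -!expnD [(M + N)%N]addnC.
have SM x1 x2 : (exists N c, x1 ^+ (q ^ N) = tens_r D c) ->
    (exists N c, x2 ^+ (q ^ N) = tens_r D c) -> exists N c, (x1 * x2) ^+ (q ^ N) = tens_r D c.
  move=> [N [c cE]] [M [c' cE']]; exists (N + M)%N, (c ^+ (q ^ M) * c' ^+ (q ^ N)).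
  by rewrite exprMn rmorphM !rmorphXn -cE -cE' -!exprM -!expnD [(M + N)%N]addnC.
move: x; apply: tensor_ind.
- apply: mpoly_ind.
  + move=> c; exists 0%N, (g (alg_map X c)).
    by rewrite -tens_comm alg_funE expn0 expr1.
  + by move=> i; exists (d i), (g (mpoly_var k i)); rewrite -tens_comm power_map_var rmorphXn.
  + by move=> x y; rewrite rmorphD; exact: SD.
  + by move=> x y; rewrite rmorphM; exact: SM.
- by move=> c; exists 0%N, c; rewrite expn0 expr1.
- move=> x y Px Py; apply: SD => //; rewrite -mulN1r; apply: SM => //.
  by exists 0%N, (-1); rewrite expn0 expr1 rmorphN1.
- exact: SM.
Qed.

Definition eventually_zero : set (nat -> C) := fun s => exists N, forall n, (N <= n)%N -> s n = 0.

Lemma eventually_zero_ideal : is_ideal eventually_zero.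
Proof.
split=> [|s t [N sN] [M tM]|a s [N sN]]; first by exists 0%N.
  exists (N + M)%N => n nNM; change (s n + t n = 0).
  rewrite (sN n (leq_trans (leq_addr M N) nNM)) add0r.
  exact: tM n (leq_trans (leq_addl N M) nNM).
by exists N => n nN; change (a n * s n = 0); rewrite sN // mulr0.
Qed.

(* A substitute for the perfect closure of [C]: the sequence [s] stands for
   the limit of the [q^n]-th roots of [s n]. *)
Definition perfection : comPzRingType := quot eventually_zero.
Definition perf_proj : {rmorphism (nat -> C) -> perfection} := @quot_proj _ eventually_zero.

Lemma perf_proj_eq s t : perf_proj s = perf_proj t <-> eventually_zero (s - t).
Proof.
rewrite /perf_proj /= quot_eqP; split=> [|st].
  have [e0 eD eM] := eventually_zero_ideal.
  by move=> [n [a [f [ef ->]]]]; apply: (big_ind eventually_zero) => // i _; exact/eM/ef.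
by exists 1%N, (fun=> 1), (fun=> s - t); rewrite big_ord1 mul1r.
Qed.

(** The embedding of C up to nilpotents: the q^n-th root of c^(q^n) is c itself. *)
Definition iter_frob (c : C) : nat -> C := fun n => c ^+ (q ^ n).

Fact iter_frob_zmod : zmod_morphism iter_frob.
Proof.
move=> x y; apply/funext => n; change (iter_frob (x - y) n = iter_frob x n - iter_frob y n).
apply/eqP; rewrite eq_sym subr_eq; apply/eqP.
rewrite /iter_frob -(finField_exprDn (g \o alg_map X)).
by rewrite subrK.
Qed.

Fact iter_frob_monoid : monoid_morphism iter_frob.
Proof.
split=> [|x y]; apply/funext => n; first exact: expr1n.
exact: exprMn.
Qed.

HB.instance Definition _ := GRing.isZmodMorphism.Build C (nat -> C) iter_frob iter_frob_zmod.
HB.instance Definition _ := GRing.isMonoidMorphism.Build C (nat -> C) iter_frob iter_frob_monoid.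

Definition to_perf : {rmorphism C -> perfection} := perf_proj \o iter_frob.

Definition perf_alg : algebra k := Algebra (to_perf \o (g \o alg_map X)).

(** Sends the variable i to the root of order q^(d i) of its image in C. For n < d i the truncated
    subtraction gives a meaningless entry, which is harmless modulo [eventually_zero]. *)
Definition perf_root : alg_hom X perf_alg :=
  mpoly_eval (B := perf_alg) (fun i => perf_proj (fun n => g (mpoly_var k i) ^+ (q ^ (n - d i)))).

Lemma perf_root_comm x : perf_root (power_map x) = to_perf (g x).
Proof.
pose h := @AlgHom k X perf_alg (to_perf \o g) (fun c => erefl).
suff E : alg_comp perf_root power_map = h by rewrite -[RHS]/(h x) -E.
apply: mpoly_hom_ext => i.
change (perf_root (power_map (mpoly_var k i)) = to_perf (g (mpoly_var k i))).
rewrite power_map_var rmorphXn mpoly_eval_var -[LHS]rmorphXn.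
apply/perf_proj_eq; exists (d i) => n dn.
set s := (X in X ^+ _); change ((s ^+ (q ^ d i)) n - g (mpoly_var k i) ^+ (q ^ n) = 0).
have -> m : (s ^+ m) n = s n ^+ m by elim: m => // m IHm; rewrite !exprS -IHm.
by rewrite /s -exprM -expnD subnK // subrr.
Qed.

(** Copairing [perf_root] with [to_perf] maps D to the perfection. An element c that dies in D
    therefore dies there, which means that c^(q^N) = 0 for large N. *)
Lemma power_map_nil c : tens_r D c = 0 -> exists n, c ^+ n = 0.
Proof.
move=> c0; have := tens_copair_r D perf_root_comm c; rewrite c0 rmorph0.
rewrite -(rmorph0 perf_proj) => /perf_proj_eq[N cN]; exists (q ^ N)%N.
have /eqP := cN N (leqnn N).
change (0 - c ^+ (q ^ N) == 0 -> c ^+ (q ^ N) = 0).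
by rewrite sub0r oppr_eq0 => /eqP.
Qed.
End BaseChange.

Lemma power_map_universal_homeomorphism : universal_homeomorphism_ring power_map.
Proof.
move=> C g D; apply: (@power_homeomorphism _ _ _ q).
- by apply/card_gt0P; exists 0.
- exact: (finField_exprDn (tens_r D \o g \o alg_map X)).
- exact: power_map_power.
- exact: power_map_nil.
Qed.
End PowerMap.

(** * Quotients of polynomial algebras *)

Section QuotientAlgebra.
Variables (k : fieldType) (I : choiceType) (E : set (mpoly k I)).

Definition quot_alg : algebra k := Algebra (@quot_proj _ E \o alg_map (mpoly_alg k I)).

Definition quot_var (i : I) : quot_alg := @quot_proj _ E (mpoly_var k i).

Lemma quot_proj_eq0 x : E x -> @quot_proj _ E x = 0.
Proof.
move=> Ex; rewrite -(rmorph0 (@quot_proj _ E)); apply/quot_eqP; rewrite subr0.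
by exists 1%N, (fun=> 1), (fun=> x); rewrite big_ord1 mul1r.
Qed.

Lemma quot_proj_surj (a : quot_alg) : exists x, @quot_proj _ E x = a.
Proof. by exists (repr (a : quot E)); exact: reprK. Qed.

Lemma quot_hom_ext (B : algebra k) (f g : alg_hom quot_alg B) :
  (forall i, f (quot_var i) = g (quot_var i)) -> f = g.
Proof.
move=> fg; apply: alg_hom_ext => a; have [x <-] := quot_proj_surj a.
pose pr := @AlgHom k (mpoly_alg k I) quot_alg (@quot_proj _ E) (fun c => erefl).
have H : alg_comp f pr = alg_comp g pr by apply: mpoly_hom_ext.
by rewrite -[LHS]/(alg_comp f pr x) H.
Qed.

Section Lift.
Variables (B : algebra k) (y : I -> B).
Hypothesis Ey : forall x, E x -> mpoly_eval y x = 0.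

Definition quot_lift_fun (x : quot_alg) : B := mpoly_eval y (repr (x : quot E)).

Lemma quot_lift_proj x : quot_lift_fun (@quot_proj _ E x) = mpoly_eval y x.
Proof.
apply/eqP; rewrite -subr_eq0 /quot_lift_fun -rmorphB; apply/eqP.
have /quot_eqP[n [a [f [Ef ->]]]] := reprK (@quot_proj _ E x).
by rewrite rmorph_sum big1 // => i _; rewrite rmorphM (Ey (Ef i)) mulr0.
Qed.

Fact quot_lift_zmod : zmod_morphism quot_lift_fun.
Proof.
move=> u v; have [x <-] := quot_proj_surj u; have [x' <-] := quot_proj_surj v.
by rewrite -rmorphB !quot_lift_proj rmorphB.
Qed.

Fact quot_lift_monoid : monoid_morphism quot_lift_fun.
Proof.
split; first by rewrite -(rmorph1 (@quot_proj _ E)) quot_lift_proj rmorph1.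
move=> u v; have [x <-] := quot_proj_surj u; have [x' <-] := quot_proj_surj v.
by rewrite -rmorphM !quot_lift_proj rmorphM.
Qed.

HB.instance Definition _ := GRing.isZmodMorphism.Build quot_alg B quot_lift_fun quot_lift_zmod.
HB.instance Definition _ := GRing.isMonoidMorphism.Build quot_alg B quot_lift_fun quot_lift_monoid.

Lemma quot_lift_alg c : quot_lift_fun (alg_map quot_alg c) = alg_map B c.
Proof. by rewrite [LHS]quot_lift_proj alg_funE. Qed.

Definition quot_lift : alg_hom quot_alg B :=
  @AlgHom k quot_alg B (quot_lift_fun : {rmorphism quot_alg -> B}) quot_lift_alg.

Lemma quot_lift_var i : quot_lift (quot_var i) = y i.
Proof. by rewrite [LHS]quot_lift_proj mpoly_eval_var. Qed.
End Lift.
End QuotientAlgebra.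

Definition power_relations (k : fieldType) (I : choiceType) (d : I -> nat) : set (mpoly k I) :=
  fun x => exists i, x = mpoly_var k i ^+ d i.

Lemma quot_varX (k : fieldType) (I : choiceType) (d : I -> nat) i :
  quot_var (@power_relations k I d) i ^+ d i = 0.
Proof. by rewrite -[LHS]rmorphXn; apply: quot_proj_eq0; exists i. Qed.

Lemma power_relations_eval (k : fieldType) (I : choiceType) (d : I -> nat) (B : algebra k)
    (y : I -> B) :
  (forall i, y i ^+ d i = 0) -> forall x, power_relations d x -> mpoly_eval y x = 0.
Proof. by move=> yd _ [i ->]; rewrite rmorphXn mpoly_eval_var. Qed.

Section NilpotentSpan.
Variables (k : fieldType) (A : algebra k) (m D : nat) (x : 'I_m -> A).
Hypothesis xD : forall j, x j ^+ D = 0.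

Definition nil_monom (f : {ffun 'I_m -> 'I_D}) : A := \prod_j x j ^+ f j.

Definition nil_span (a : A) : Prop :=
  exists c : {ffun 'I_m -> 'I_D} -> k, a = \sum_f alg_map A (c f) * nil_monom f.

Let spanU c f : nil_span (alg_map A c * nil_monom f).
Proof.
exists (fun g => if g == f then c else 0); rewrite (bigD1 f) //= eqxx big1 ?addr0 //.
by move=> g /negbTE ->; rewrite rmorph0 mul0r.
Qed.

Lemma nil_spanD a b : nil_span a -> nil_span b -> nil_span (a + b).
Proof.
move=> [c ->] [c' ->]; exists (fun f => c f + c' f); rewrite -big_split.
by apply: eq_bigr => f _; rewrite rmorphD mulrDl.
Qed.

Lemma nil_span0 : nil_span 0.
Proof. by exists (fun=> 0); rewrite big1 // => f _; rewrite rmorph0 mul0r. Qed.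

(** A monomial with some exponent at least D vanishes, so the span of the bounded monomials contains
    all of them and is closed under products. *)
Let span_monom c (f : 'I_m -> nat) : nil_span (alg_map A c * \prod_j x j ^+ f j).
Proof.
have [/forallP fD|/forallPn[j]] := boolP [forall j, (f j < D)%N].
  have := spanU c [ffun j => Ordinal (fD j)]; rewrite /nil_monom.
  by under eq_bigr => j _ do rewrite ffunE.
rewrite -leqNgt => fj; rewrite (bigD1 j) //= -(subnK fj) exprD xD mulr0 mul0r mulr0.
exact: nil_span0.
Qed.

Lemma nil_span_const c : nil_span (alg_map A c).
Proof.
have := span_monom c (fun=> 0%N).
by rewrite big1 ?mulr1.
Qed.

Lemma nil_span_gen j : nil_span (x j).
Proof.
have := span_monom 1 (fun i => (i == j) : nat); rewrite (bigD1 j) //= eqxx rmorph1 mul1r.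
by rewrite big1 ?mulr1 ?expr1 // => i /negbTE ->.
Qed.

Lemma nil_spanM a b : nil_span a -> nil_span b -> nil_span (a * b).
Proof.
move=> [c ->] [c' ->]; rewrite mulr_suml.
apply: (big_ind nil_span nil_span0 nil_spanD) => f _; rewrite mulr_sumr.
apply: (big_ind nil_span nil_span0 nil_spanD) => g _.
rewrite mulrACA -rmorphM /nil_monom -big_split /=.
by under eq_bigr => j _ do rewrite -exprD; exact: span_monom.
Qed.

Lemma nil_span_finite : (forall a, nil_span a) -> finite_dimensional A.
Proof.
move=> span; exists #|{: {ffun 'I_m -> 'I_D}}|, (fun i => nil_monom (enum_val i)) => a.
have [c ->] := span a; exists (fun i => c (enum_val i)).
by rewrite (reindex _ (onW_bij _ (enum_val_bij _))).
Qed.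
End NilpotentSpan.

Section InfinitesimalAlgebra.
Variables (k : fieldType) (I : choiceType) (d : I -> nat) (s : seq I).
Hypothesis d_gt0 : forall i, (0 < d i)%N.
Hypothesis d_supp : forall i, i \notin s -> d i = 1%N.
Local Notation A := (quot_alg (@power_relations k I d)).
Local Notation x := (quot_var (@power_relations k I d)).

Lemma power_quot_finite : finite_dimensional A.
Proof.
(* A single exponent, at least d_i for every i in [s], that kills all the relevant variables. *)
pose D := (\sum_(i <- s) d i)%N; pose xs (j : 'I_(size s)) := x (tnth (in_tuple s) j).
have xD j : xs j ^+ D = 0.
  rewrite -(@subnK (d (tnth (in_tuple s) j)) D) ?exprD ?quot_varX ?mulr0 //.
  rewrite /D (big_tnth _ _ s) (bigD1 j) //=.
  exact: leq_addr.
apply: (nil_span_finite (x := xs) (D := D)) => a.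
have [y <-] := quot_proj_surj a; elim/mpoly_ind: y {a}.
- by move=> c; exact: (nil_span_const xD).
- move=> i; have [/seq_tnthP[j ij]|/d_supp di] := boolP (i \in s).
    by rewrite -[_ (mpoly_var k i)]/(x i) ij; exact: (nil_span_gen xD).
  rewrite (_ : _ (mpoly_var k i) = 0); first exact: nil_span0.
  by have := @quot_varX k I d i; rewrite di expr1.
- by move=> a b Pa Pb; rewrite rmorphD; exact: nil_spanD.
- by move=> a b Pa Pb; rewrite rmorphM; exact: (nil_spanM xD).
Qed.

Definition field_alg : algebra k := Algebra (idfun : {rmorphism k -> k}).

Lemma power_quot_aug_subproof y : power_relations d y ->
  mpoly_eval (B := field_alg) (fun=> 0) y = 0.
Proof. by apply: power_relations_eval => i; rewrite expr0n gtn_eqF. Qed.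

Definition power_quot_aug : alg_hom A field_alg := quot_lift power_quot_aug_subproof.

Lemma power_quot_aug_prime : prime_ideal (fun a : A => power_quot_aug a = 0).
Proof.
split; first split.
- by rewrite rmorph0.
- by move=> a b a0 b0; rewrite rmorphD a0 b0 addr0.
- by move=> a b b0; rewrite rmorphM b0 mulr0.
- by rewrite rmorph1 => /eqP; rewrite (oner_eq0 k).
- move=> a b; rewrite rmorphM => /eqP; rewrite (mulf_eq0 (power_quot_aug a : k)).
  by case/orP => /eqP; [left|right].
Qed.

(** Every prime contains the nilpotent variables, hence the difference of any element and its
    constant term; so it coincides with the kernel of the augmentation. *)
Lemma power_quot_one_point : exists p : spec A, forall p' : spec A, p' = p.
Proof.
exists (Spec power_quot_aug_prime) => p'; case: (spec_prime p') => pI p1 pM.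
have [p0 pD pMl] := pI.
pose pr : {rmorphism mpoly k I -> A} := @quot_proj _ (@power_relations k I d).
pose h : {rmorphism mpoly k I -> A} := alg_map A \o power_quot_aug \o pr.
have aug_proj : forall y, spec_ideal p' (pr y - h y).
  apply: mpoly_ind.
  - move=> c; rewrite (_ : pr _ - _ = 0) //; apply/eqP; rewrite subr_eq0; apply/eqP.
    exact/esym/(congr1 (alg_map A))/(alg_funE power_quot_aug).
  - move=> i; rewrite (_ : h _ = 0); last first.
      rewrite -[RHS](rmorph0 (alg_map A)); congr (alg_map A _).
      exact: (quot_lift_var power_quot_aug_subproof i).
    rewrite subr0; apply: (prime_idealX (n := d i)).
    by rewrite [X in spec_ideal _ X]quot_varX.
  - move=> a b Pa Pb; rewrite (rmorphD pr) (rmorphD h) opprD addrACA.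
    exact: (pD _ _ Pa Pb).
  - move=> a b Pa Pb; rewrite (rmorphM pr) (rmorphM h).
    have -> : pr a * pr b - h a * h b = pr b * (pr a - h a) + h a * (pr b - h b).
      by rewrite !mulrBr [pr b * pr a]mulrC [pr b * h a]mulrC addrA subrK.
    exact: (pD _ _ (pMl _ _ Pa) (pMl _ _ Pb)).
have aug a : spec_ideal p' (a - alg_map A (power_quot_aug a)).
  by have [y <-] := quot_proj_surj a; exact: aug_proj.
apply: spec_eq => a /=; split=> [pa|a0].
  have /(pMl (alg_map A (power_quot_aug a : k)^-1)) : spec_ideal p' (alg_map A (power_quot_aug a)).
    by rewrite -[alg_map _ _](subKr a); exact: ideal_sub.
  rewrite -rmorphM; have [//|ea] := eqVneq (power_quot_aug a : k) 0.
  by rewrite (mulVf ea) rmorph1.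
have {}a0 : power_quot_aug a = 0 := a0.
by have := aug a; rewrite a0 rmorph0 subr0.
Qed.
End InfinitesimalAlgebra.

(** * Pro-infinitesimal groups in coordinates *)

Section Coordinates.
Variables (k : fieldType) (G : group_functor k) (J : choiceType).
Variables (lvl : J -> nat) (d : J -> nat) (c : forall B, G B -> J -> B).
Hypothesis d_gt0 : forall p, (0 < d p)%N.
Hypothesis c_inj : forall B (x y : G B), c x =1 c y -> x = y.
Hypothesis c_map : forall (B C : algebra k) (f : alg_hom B C) (x : G B) p,
  c (gf_map G f x) p = f (c x p).
Hypothesis c_nil : forall B (x : G B) p, c x p ^+ d p = 0.
Hypothesis c_surj : forall (B : algebra k) (y : J -> B),
  (forall p, y p ^+ d p = 0) -> exists x, c x =1 y.

Definition agree N B (x y : G B) := forall p, (lvl p < N)%N -> c x p = c y p.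

Hypothesis agreeM : forall N B (x x' y y' : G B),
  agree N x x' -> agree N y y' -> agree N (x * y)%g (x' * y')%g.
Hypothesis lvl_finite : forall N, exists s : seq J, forall p, (lvl p < N)%N -> p \in s.

(** The relations [E] are arbitrary among those with the right solutions, so that the result serves
    both [power_relations] and [ker_relations]. *)
Lemma coordinates_universal_point (E : set (mpoly k J)) :
    (forall (B : algebra k) (y : J -> B),
      (forall x, E x -> mpoly_eval y x = 0) <-> (forall p, y p ^+ d p = 0)) ->
  exists a : G (quot_alg E), universal_point (F := set_of_group_functor G) a.
Proof.
move=> Ey.
have /c_surj[a aE] : forall p, quot_var E p ^+ d p = 0.
  apply/Ey => x Ex.
  pose pr := @AlgHom k (mpoly_alg k J) (quot_alg E) (@quot_proj _ E) (fun c => erefl).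
  rewrite (_ : mpoly_eval _ = pr); last by apply: mpoly_hom_ext => i; rewrite mpoly_eval_var.
  exact: quot_proj_eq0.
exists a => B x; have Ex := (Ey B (c x)).2 (c_nil x).
exists (quot_lift Ex); split.
  by apply: c_inj => p; rewrite [LHS]c_map aE quot_lift_var.
move=> f fx; apply: quot_hom_ext => i; rewrite quot_lift_var -aE -c_map.
by rewrite -[gf_map _ _ _]/(sf_map (set_of_group_functor G) f a) fx.
Qed.

Section Truncation.
Variable N : nat.

Section Points.
Variable B : algebra k.
Implicit Types x y z : G B.

Lemma trunc_subproof x : exists y, c y =1 (fun p => if (lvl p < N)%N then c x p else 0).
Proof.
by apply: c_surj => p; case: ifP => _; [exact: c_nil|rewrite expr0n gtn_eqF].
Qed.

Definition trunc x : G B := sval (cid (trunc_subproof x)).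

Lemma truncE x p : c (trunc x) p = if (lvl p < N)%N then c x p else 0.
Proof. exact: (svalP (cid (trunc_subproof x))). Qed.

Lemma trunc_agree x : agree N (trunc x) x.
Proof. by move=> p pN; rewrite truncE pN. Qed.

Lemma agree_sym x y : agree N x y -> agree N y x.
Proof. by move=> xy p pN; rewrite xy. Qed.

Lemma trunc_eq x y : agree N x y -> trunc x = trunc y.
Proof. by move=> xy; apply: c_inj => p; rewrite !truncE; case: ifP => // /xy. Qed.

Lemma truncK x : trunc (trunc x) = trunc x. Proof. exact/trunc_eq/trunc_agree. Qed.

(** The quotient of G by agreement below level N, realized on canonical representatives: those whose
    coordinates of level at least N are zero. The group law multiplies in G and truncates. *)
Definition tpt : Type := {x : G B | trunc x == x}.
HB.instance Definition _ := SubChoice.on tpt.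

Definition to_tpt x : tpt :=
  exist (fun x => is_true (trunc x == x)) (trunc x) (introT eqP (truncK x)).
Definition tpt_one := to_tpt 1%g.
Definition tpt_inv (x : tpt) := to_tpt (val x)^-1%g.
Definition tpt_mul (x y : tpt) := to_tpt (val x * val y)%g.

Lemma to_tpt_eq x y : agree N x y -> to_tpt x = to_tpt y.
Proof. by move=> xy; apply: val_inj; exact: trunc_eq. Qed.

Lemma to_tptK (x : tpt) : to_tpt (val x) = x.
Proof. by apply: val_inj; exact/eqP/(valP x). Qed.

Lemma to_tptM x y : to_tpt (x * y)%g = tpt_mul (to_tpt x) (to_tpt y).
Proof. by apply: to_tpt_eq; apply: agreeM; exact/agree_sym/trunc_agree. Qed.

Lemma tpt_mulA : associative tpt_mul.
Proof.
move=> x y z; rewrite -(to_tptK x) -(to_tptK y) -(to_tptK z).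
by rewrite -!to_tptM mulgA.
Qed.
Lemma tpt_mul1 : left_id tpt_one tpt_mul.
Proof. by move=> x; rewrite -(to_tptK x) -to_tptM mul1g. Qed.
Lemma tpt_mulr1 : right_id tpt_one tpt_mul.
Proof. by move=> x; rewrite -(to_tptK x) -to_tptM mulg1. Qed.
Lemma tpt_mulV : left_inverse tpt_one tpt_inv tpt_mul.
Proof. by move=> x; rewrite -{2}(to_tptK x) -to_tptM mulVg. Qed.
Lemma tpt_mulVr : right_inverse tpt_one tpt_inv tpt_mul.
Proof. by move=> x; rewrite -{1}(to_tptK x) -to_tptM mulgV. Qed.

HB.instance Definition _ :=
  isGroup.Build tpt tpt_mulA tpt_mul1 tpt_mulr1 tpt_mulV tpt_mulVr.

HB.instance Definition _ := monoid.isMultiplicative.Build (G B) tpt to_tpt to_tptM.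
End Points.

Section Map.
Variables (B C : algebra k) (f : alg_hom B C).

Lemma trunc_map (x : G B) : trunc (gf_map G f x) = gf_map G f (trunc x).
Proof.
apply: c_inj => p; rewrite truncE !c_map truncE.
by case: ifP => // _; rewrite rmorph0.
Qed.

Definition tpt_map (x : tpt B) : tpt C := to_tpt (gf_map G f (val x)).

Lemma tpt_map_to (x : G B) : tpt_map (to_tpt x) = to_tpt (gf_map G f x).
Proof. by rewrite /tpt_map /= -trunc_map; apply: to_tpt_eq; exact: trunc_agree. Qed.

Lemma tpt_mapM : {morph tpt_map : x y / (x * y)%g}.
Proof.
move=> x y; rewrite -(to_tptK x) -(to_tptK y) -[(_ * _)%g in LHS]to_tptM.
by rewrite !tpt_map_to gmulfM to_tptM.
Qed.

HB.instance Definition _ := monoid.isMultiplicative.Build (tpt B) (tpt C) tpt_map tpt_mapM.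
End Map.

Definition truncation : group_functor k.
Proof.
refine (@GroupFunctor k tpt
  (fun A B f => tpt_map f : {multiplicative tpt A -> tpt B}) _ _).
- by move=> A x; rewrite -[RHS]to_tptK /= /tpt_map gf_map_id.
- move=> A B C g f x; rewrite -(to_tptK x) /= !tpt_map_to; congr to_tpt.
  exact: gf_map_comp.
Defined.

Definition trunc_hom : group_functor_hom G truncation :=
  @GroupFunctorHom k G truncation (fun A => @to_tpt A : {multiplicative G A -> tpt A})
    (fun A B f x => esym (tpt_map_to f x)).
End Truncation.

Section Transition.
Variables (N M : nat) (NM : (N <= M)%N).

Lemma agree_le B (x y : G B) : agree M x y -> agree N x y.
Proof. by move=> xy p pN; apply: xy; exact: leq_trans NM. Qed.

Definition transition_fun B (x : tpt M B) : tpt N B := to_tpt N (val x).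

Lemma transition_to B (x : G B) : transition_fun (to_tpt M x) = to_tpt N x.
Proof. by apply: to_tpt_eq; apply: agree_le; exact: trunc_agree. Qed.

Lemma transition_funM B : {morph @transition_fun B : x y / (x * y)%g}.
Proof.
move=> x y; rewrite -(to_tptK x) -(to_tptK y) -[(_ * _)%g in LHS]to_tptM.
by rewrite !transition_to to_tptM.
Qed.

HB.instance Definition _ B :=
  monoid.isMultiplicative.Build (tpt M B) (tpt N B) (@transition_fun B) (@transition_funM B).

Lemma transition_nat A B (f : alg_hom A B) (x : tpt M A) :
  transition_fun (tpt_map f x) = tpt_map f (transition_fun x).
Proof. by rewrite -(to_tptK x) tpt_map_to !transition_to tpt_map_to. Qed.

Definition transition : group_functor_hom (truncation M) (truncation N) :=
  @GroupFunctorHom k (truncation M) (truncation N)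
    (fun A => @transition_fun A : {multiplicative tpt M A -> tpt N A}) transition_nat.
End Transition.

Lemma truncation_infinitesimal N : infinitesimal (truncation N).
Proof.
(* Exponent one kills the variables of level at least N, so the truncation is represented over the
   same index set [J]. *)
pose dN p := if (lvl p < N)%N then d p else 1%N.
have dN_gt0 p : (0 < dN p)%N by rewrite /dN; case: ifP.
have [s sP] := lvl_finite N.
have dN_supp p : p \notin s -> dN p = 1%N.
  by rewrite /dN; case: ifP => // /sP ->.
pose E := @power_relations k J dN.
have dN_nil (B : algebra k) (b : B) p : b ^+ dN p = 0 -> b ^+ d p = 0.
  rewrite /dN; case: ifP => // _; rewrite expr1 => ->.
  by rewrite expr0n gtn_eqF.
have /c_surj[a aE] p : quot_var E p ^+ d p = 0 by apply: dN_nil; exact: quot_varX.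
have aN : trunc N a = a.
  apply: c_inj => p; rewrite truncE; case: ifP => // pN.
  by rewrite aE; have := @quot_varX k J dN p; rewrite /dN pN expr1.
exists (quot_alg E), (to_tpt N a : set_of_group_functor (truncation N) _); split.
- move=> B x; have yE : forall z, E z -> mpoly_eval (c (val x)) z = 0.
    apply: power_relations_eval => p; rewrite /dN; case: ifP => [_|pN]; first exact: c_nil.
    by rewrite -(eqP (valP x)) truncE pN expr1.
  exists (quot_lift yE); split.
    rewrite [LHS]tpt_map_to -[RHS]to_tptK; congr to_tpt.
    by apply: c_inj => p; rewrite c_map aE quot_lift_var.
  move=> f fx; apply: quot_hom_ext => i; rewrite quot_lift_var -aE -c_map.
  rewrite -fx [X in c (val X)]tpt_map_to /= trunc_map; congr (c (gf_map G f _) i).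
  exact/esym.
- exact: (power_quot_finite k dN_supp).
- exact: power_quot_one_point.
Qed.

Lemma coordinates_pro_infinitesimal : pro_infinitesimal G.
Proof.
split.
  have [|a aP] := @coordinates_universal_point (@power_relations k J d); last by exists _, a.
  move=> B y; split=> [yE p|]; last exact: power_relations_eval.
  by rewrite -(mpoly_eval_var y) -rmorphXn yE //; exists p.
exists nat, (fun i j => (i <= j)%N), truncation, transition, trunc_hom; split.
- split; [exact: inhabits 0%N | exact: leqnn | by move=> i j l; exact: leq_trans|].
  by move=> i j; exists (i + j)%N; rewrite leq_addr leq_addl.
- exact: truncation_infinitesimal.
- split=> [i l A x|i j l a b c' A x]; first exact: to_tptK.
  by rewrite -(to_tptK x) /= !transition_to.
- by move=> i j a A x; exact: transition_to.
- move=> A y yE.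
  (* Coordinate p is read at stage lvl p + 1, the first one that retains it. *)
  have [|x xE] := c_surj (y := fun p => c (val (y (lvl p).+1)) p); first by move=> p; exact: c_nil.
  exists x; split.
    move=> N; rewrite -[RHS]to_tptK; apply: to_tpt_eq => p pN.
    by rewrite xE -(yE _ _ pN) /= truncE ltnSn.
  move=> x' x'E; apply: c_inj => p; rewrite xE -x'E.
  by rewrite /= truncE ltnSn.
Qed.
End Coordinates.

Lemma universal_point_iso (k : comPzRingType) (F : set_functor k) (A : algebra k) (a : F A) :
  universal_point a -> set_functor_iso F (spec_functor A).
Proof.
move=> aP; have uniq B (x : F B) : exists f : alg_hom A B, sf_map F f a = x.
  by have [f [fE _]] := aP B x; exists f.
have inj B (f g : alg_hom A B) : sf_map F f a = sf_map F g a -> f = g.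
  move=> fg; have [h [_ hE]] := aP B (sf_map F g a).
  by rewrite -(hE f) // -(hE g).
pose u B (x : F B) : spec_functor A B := sval (cid (uniq B x)).
have uE B x : sf_map F (u B x) a = x by exact: (svalP (cid (uniq B x))).
have u_nat B C (f : alg_hom B C) x : u C (sf_map F f x) = sf_map (spec_functor A) f (u B x).
  by apply: inj; rewrite uE sf_map_comp uE.
exists (SetFunctorHom u_nat) => B; exists (fun f => sf_map F f a) => [x|f].
  exact: uE.
by apply: inj; rewrite uE.
Qed.

Section KernelPoints.
Variables (k : comPzRingType) (F G : ring_functor k) (f : ring_functor_hom F G).

Definition ker_val (A : algebra k) (x : kernel f A) : F A := val (x : ker_pt f A).

Lemma ker_val_inj A : injective (@ker_val A).
Proof. exact: val_inj. Qed.

Lemma ker_valM A (x y : kernel f A) : ker_val (x * y)%g = ker_val x + ker_val y.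
Proof. by []. Qed.

Lemma ker_val_map A B (g : alg_hom A B) (x : kernel f A) :
  ker_val (gf_map (kernel f) g x) = rf_map F g (ker_val x).
Proof. by []. Qed.

Lemma ker_val_eq0 A (x : kernel f A) : f A (ker_val x) = 0.
Proof. exact/eqP/(valP (x : ker_pt f A)). Qed.

Lemma ker_val_surj A (x : F A) : f A x = 0 -> exists y : kernel f A, ker_val y = x.
Proof. by move=> /eqP fx; exists (exist (fun z => is_true (f A z == 0)) x fx). Qed.
End KernelPoints.

(** * The special fiber of [u_ra] *)

Section SpecialFiberMorphism.
Variables (O O' : idomainType) (iota : {rmorphism O -> O'}) (pi : O) (varpi v : O').
Variables (k : finFieldType) (rho' : {rmorphism O' -> k}) (e : nat).
Local Notation q := #|k|.
Variables (W : witt pi q) (W' : witt varpi q) (u : drinfeld iota W W').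
Variable T : forall A : algebra O, tensor (alg_map (W A)) iota.
Hypotheses (pi_neq0 : pi != 0) (varpi_neq0 : varpi != 0) (rho'_varpi : rho' varpi = 0).
Hypotheses (v_unit : v \is a GRing.unit) (e_gt0 : (0 < e)%N).
Hypothesis piE : iota pi = v * varpi ^+ e.
Variables (b : free_basis iota e) (bE : forall i, b i = varpi ^+ i).

Let q_gt1 : (1 < q)%N. Proof. exact: finNzRing_gt1. Qed.

Local Notation J := (nat * 'I_e)%type.
Local Notation source := (base_change rho' (base_change iota (prod_witt T))).
Local Notation target := (base_change rho' (witt_functor W')).
Local Notation ura := (base_change_hom rho' (u_ra T u)).

Definition frob_deg (p : J) : nat := (p.1 * (e - 1) + p.2)%N.

Section Points.
Variable B : algebra k.
Local Notation BO := (restr iota (restr rho' B)).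

Let varpi0 : alg_map (restr rho' B) varpi = 0.
Proof. by rewrite /= rho'_varpi rmorph0. Qed.

Lemma source_vec_subproof (x : source B) :
  exists y : {ffun 'I_e -> W BO}, x = tens_sum b (T BO) y.
Proof.
have [y xE] := tens_sum_surj b (x : T BO); exists (finfun y); rewrite xE.
by apply: eq_bigr => i _; rewrite ffunE.
Qed.

Definition source_vec (x : source B) : {ffun 'I_e -> W BO} := sval (cid (source_vec_subproof x)).

Lemma source_vecE x : x = tens_sum b (T BO) (source_vec x).
Proof. exact: (svalP (cid (source_vec_subproof x))). Qed.

Lemma source_vec_tens y : source_vec (tens_sum b (T BO) y : source B) =1 y.
Proof. by apply: (tens_sum_inj (b := b) (T := T BO)); rewrite -source_vecE. Qed.

Definition source_coord (x : source B) (p : J) : B := witt_coord (source_vec x p.2) p.1.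

Definition of_coord (y : J -> B) : source B :=
  tens_sum b (T BO) (fun i => witt_of_seq W (B := BO) (fun n => y (n, i))).

Lemma of_coordK y : source_coord (of_coord y) =1 y.
Proof. by case=> n i; rewrite /source_coord source_vec_tens [LHS]witt_of_seqK. Qed.

Lemma source_coord_inj x x' : source_coord x =1 source_coord x' -> x = x'.
Proof.
move=> xx'; rewrite (source_vecE x) (source_vecE x').
rewrite (_ : source_vec x = source_vec x') //; apply/ffunP => i; apply: witt_ext => n.
exact: xx' (n, i).
Qed.

Lemma source_expansion (x : source B) :
  expansion v e_gt0 (ura B x : W' (restr rho' B)) (fun p => source_coord x p ^+ (q ^ frob_deg p)).
Proof.
have H := u_ra_expansion u pi_neq0 varpi_neq0 q_gt1 e_gt0 piE varpi0 bE T (source_vec x).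
rewrite -source_vecE in H; move: H; congr (expansion _ _ _ _).
by apply/funext => p; rewrite /frob_deg subn1.
Qed.

(** [source_vec] is additive, and agreement of the first N Witt coordinates is congruence modulo the
    subgroup V^N W. This provides the truncations of the kernel with a group law. *)
Lemma source_coordD N (x x' y y' : source B) :
    (forall p, (p.1 < N)%N -> source_coord x p = source_coord x' p) ->
    (forall p, (p.1 < N)%N -> source_coord y p = source_coord y' p) ->
  forall p, (p.1 < N)%N -> source_coord (x + y) p = source_coord (x' + y') p.
Proof.
have vecD (z z' : source B) i : source_vec (z + z') i = source_vec z i + source_vec z' i.
  move: i; apply: (tens_sum_inj (b := b) (T := T BO)); rewrite -source_vecE.
  rewrite {1}(source_vecE z) {1}(source_vecE z') -big_split; apply: eq_bigr => i _.
  by rewrite rmorphD mulrDl.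
move=> xx' yy' [n i] /= nN; rewrite /source_coord !vecD /=.
move: n nN; apply: (proj2 (@witt_coord_congr _ _ _ W pi_neq0 q_gt1 BO N _ _)).
have [z ->] : exists z, source_vec x i = source_vec x' i + iter N (witt_V (B := BO)) z.
  by apply: (proj1 (@witt_coord_congr _ _ _ W pi_neq0 q_gt1 BO N _ _)) => n nN;
    exact: (xx' (n, i) nN).
have [z' ->] : exists z, source_vec y i = source_vec y' i + iter N (witt_V (B := BO)) z.
  by apply: (proj1 (@witt_coord_congr _ _ _ W pi_neq0 q_gt1 BO N _ _)) => n nN;
    exact: (yy' (n, i) nN).
by exists (z + z'); rewrite iterVD // addrACA.
Qed.

Lemma u_ra_eq0 (x : source B) :
  ura B x = 0 <-> forall p, source_coord x p ^+ (q ^ frob_deg p) = 0.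
Proof.
have H := source_expansion x; split=> [x0|].
  rewrite x0 in H.
  exact: (proj1 (expansion0 W' varpi_neq0 q_gt1 v_unit e_gt0 (B := restr rho' B) _) H).
move=> y0; have H0 := proj2 (expansion0 W' varpi_neq0 q_gt1 v_unit e_gt0 (B := restr rho' B) _) y0.
exact: (expansion_inj varpi_neq0 q_gt1 H H0).
Qed.
End Points.

Lemma source_coord_map (B C : algebra k) (f : alg_hom B C) (x : source B) p :
  source_coord (rf_map source f x) p = f (source_coord x p).
Proof.
have -> : rf_map source f x = tens_sum b (T (restr iota (restr rho' C)))
    (fun i => witt_map W (restr_hom iota (restr_hom rho' f)) (source_vec x i)).
  rewrite {1}(source_vecE x) rmorph_sum; apply: eq_bigr => i _.
  by rewrite rmorphM /= /tensor_map tens_copair_l tens_copair_r.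
by rewrite /source_coord source_vec_tens [LHS]witt_mapE.
Qed.

Section FreeAlgebra.
Variables (X : algebra k) (x : J -> X) (ev : forall B : algebra k, (J -> B) -> alg_hom X B).
Hypothesis evE : forall B y p, @ev B y (x p) = y p.
Hypothesis hom_ext : forall (B : algebra k) (f g : alg_hom X B),
  (forall p, f (x p) = g (x p)) -> f = g.

Lemma source_universal_point :
  universal_point (F := set_of_ring_functor source) (of_coord x).
Proof.
move=> B z; exists (ev (source_coord z)); split.
  by apply: source_coord_inj => p; rewrite [LHS]source_coord_map of_coordK evE.
move=> f fz; apply: hom_ext => p; rewrite evE.
by rewrite -fz [LHS]source_coord_map of_coordK.
Qed.

(** W' is given the digits of the expansion as coordinates instead of the Witt coordinates.
    Existence and uniqueness of digits make this a coordinate system, and u_ra becomes a power map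
    in it. *)
Lemma target_universal_point (w : target X) :
    expansion v e_gt0 (w : W' (restr rho' X)) x ->
  universal_point (F := set_of_ring_functor target) w.
Proof.
move=> wE B z.
have [y zy] := expansion_digits varpi_neq0 q_gt1 v_unit e_gt0 (z : W' (restr rho' B)).
exists (ev y); split.
  apply: (expansion_inj varpi_neq0 q_gt1 _ zy).
  have := expansion_map (restr_hom rho' (ev y)) wE.
  by congr (expansion _ _ _ _); apply/funext => p; exact: evE.
move=> f fz; apply: hom_ext => p; rewrite evE.
have := expansion_map (restr_hom rho' f) wE; rewrite [witt_map _ _ _]fz => zf.
exact: (expansion_uniq varpi_neq0 q_gt1 v_unit zy zf).
Qed.

Lemma u_ra_universal_homeomorphism_of (phi : alg_hom X X) :
    (forall p, phi (x p) = x p ^+ (q ^ frob_deg p)) -> universal_homeomorphism_ring phi ->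
  universal_homeomorphism (set_of_ring_functor_hom ura).
Proof.
move=> phiE phi_homeo.
have [w wE] := expansion_sum v W' varpi_neq0 q_gt1 e_gt0 (B := restr rho' X) x.
exists X, (of_coord x), X, w, phi; split=> //.
- exact: source_universal_point.
- exact: target_universal_point.
(* Both points of W' have the digits x_p^(q^(frob_deg p)), and a point is determined by its
   digits. *)
- apply: (expansion_inj varpi_neq0 q_gt1 _ (source_expansion _)).
  have := expansion_map (restr_hom rho' phi) wE.
  by congr (expansion _ _ _ _); apply/funext => p; rewrite of_coordK; exact: phiE.
Qed.
End FreeAlgebra.

Lemma u_ra_universal_homeomorphism : universal_homeomorphism (set_of_ring_functor_hom ura).
Proof.
exact: (@u_ra_universal_homeomorphism_of (mpoly_alg k J) (@mpoly_var k J) (@mpoly_eval k J)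
  (@mpoly_eval_var k J) (@mpoly_hom_ext k J) (power_map k frob_deg)
  (@power_map_var k J frob_deg) (@power_map_universal_homeomorphism k J frob_deg)).
Qed.

Definition kernel_coord (B : algebra k) (x : kernel ura B) : J -> B :=
  source_coord (ker_val x).

Let d_gt0 p : (0 < q ^ frob_deg p)%N.
Proof. by rewrite expn_gt0 (ltnW q_gt1). Qed.

Lemma kernel_coord_inj B (x y : kernel ura B) : kernel_coord x =1 kernel_coord y -> x = y.
Proof. by move=> xy; apply: ker_val_inj; exact: source_coord_inj. Qed.

Lemma kernel_coord_map (B C : algebra k) (f : alg_hom B C) (x : kernel ura B) p :
  kernel_coord (gf_map (kernel ura) f x) p = f (kernel_coord x p).
Proof. by rewrite /kernel_coord ker_val_map source_coord_map. Qed.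

Lemma kernel_coord_nil B (x : kernel ura B) p : kernel_coord x p ^+ (q ^ frob_deg p) = 0.
Proof. by move: p; apply/u_ra_eq0/ker_val_eq0. Qed.

Lemma kernel_coord_surj (B : algebra k) (y : J -> B) :
  (forall p, y p ^+ (q ^ frob_deg p) = 0) -> exists x : kernel ura B, kernel_coord x =1 y.
Proof.
move=> y0; have /ker_val_surj[x xE] : ura B (of_coord y) = 0.
  by apply/u_ra_eq0 => p; rewrite of_coordK.
by exists x => p; rewrite /kernel_coord xE of_coordK.
Qed.

Lemma kernel_coordM N B (x x' y y' : kernel ura B) :
    (forall p, (p.1 < N)%N -> kernel_coord x p = kernel_coord x' p) ->
    (forall p, (p.1 < N)%N -> kernel_coord y p = kernel_coord y' p) ->
  forall p, (p.1 < N)%N -> kernel_coord (x * y)%g p = kernel_coord (x' * y')%g p.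
Proof. by rewrite /kernel_coord !ker_valM; exact: source_coordD. Qed.

Lemma kernel_pro_infinitesimal : pro_infinitesimal (kernel ura).
Proof.
apply: (@coordinates_pro_infinitesimal _ _ _ (fun p => p.1) (fun p => q ^ frob_deg p)%N
  kernel_coord d_gt0 kernel_coord_inj kernel_coord_map kernel_coord_nil kernel_coord_surj
  kernel_coordM) => N.
exists [seq (n, i) | n <- seq.iota 0 N, i <- enum 'I_e] => -[n i] nN.
by apply/allpairsP; exists (n, i); rewrite mem_iota mem_enum.
Qed.

Lemma kernel_iso_ker_ring :
  set_functor_iso (set_of_group_functor (kernel ura)) (spec_functor (ker_ring k q e)).
Proof.
have [|a aP] := @coordinates_universal_point _ _ _ (fun p => q ^ frob_deg p)%N kernel_coord
  kernel_coord_inj kernel_coord_map kernel_coord_nil kernel_coord_surj (@ker_relations k q e).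
  move=> B y; split=> [yE [n i]|y0 _ [n [i ->]]].
    rewrite -(mpoly_eval_var y) -rmorphXn yE //.
    by exists n, i.
  by rewrite rmorphXn [mpoly_eval _ _]mpoly_eval_var; exact: (y0 (n, i)).
exact: (universal_point_iso aP).
Qed.
End SpecialFiberMorphism.

Theorem proposition4p29
    (O : idomainType) (O_dvr : is_dvr O)
    (pi : O) (pi_unif : is_uniformizer pi) (O_complete : adically_complete pi)
    (kappa : finFieldType) (rho : {rmorphism O -> kappa})
    (rho_res : is_residue_map rho)
    (K' : fieldExtType {fraction O})
    (O' : idomainType) (j : {rmorphism O' -> K'})
    (O'_int : is_integral_closure j)
    (iota : {rmorphism O -> O'})
    (iotaE : forall a : O, j (iota a) = (tofrac a)%:A)
    (varpi : O') (varpi_unif : is_uniformizer varpi)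
    (rho' : {rmorphism O' -> kappa}) (rho'_res : is_residue_map rho')
    (rho'E : forall a : O, rho' (iota a) = rho a)
    (e : nat) (ram : totally_ramified K' iota pi varpi e)
    (W : witt pi #|kappa|) (W' : witt varpi #|kappa|)
    (u : drinfeld iota W W')
    (T : forall A : algebra O, tensor (alg_map (W A)) iota) :
  let u_ra_kappa := base_change_hom rho' (u_ra T u) in
  [/\ universal_homeomorphism (set_of_ring_functor_hom u_ra_kappa),
      pro_infinitesimal (kernel u_ra_kappa) &
      set_functor_iso (set_of_group_functor (kernel u_ra_kappa))
        (spec_functor (ker_ring kappa #|kappa| e))].
Proof.
move=> u_ra_kappa.
have pi_neq0 := uniformizer_neq0 O_dvr pi_unif.
have [_ [v v_unit piE]] := ram.
have varpi_nonunit := uniformizer_nonunit varpi_unif.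
have iota_inj : injective iota.
  move=> a a' /(congr1 j); rewrite !iotaE => /eqP; rewrite -subr_eq0 -scalerBl.
  rewrite scaler_eq0 oner_eq0 orbF -tofracB tofrac_eq0 subr_eq0.
  by move/eqP.
have rho'_varpi : rho' varpi = 0 by apply/rho'_res.2.
(* For e = 0 the element iota(pi) would be the unit [v], yet [pi] maps to zero in the residue
   field. *)
have e_gt0 : (0 < e)%N.
  rewrite lt0n; apply/eqP => e0; move: piE; rewrite e0 mulr1 => piE.
  have : rho' v != 0.
    by rewrite -unitfE rmorph_unit.
  by rewrite -piE rho'E (rho_res.2 pi).2 ?eqxx // uniformizer_nonunit.
have varpi_neq0 : varpi != 0.
  apply: contraNneq pi_neq0 => varpi0; have : iota pi = 0.
    by rewrite piE varpi0 expr0n gtn_eqF // mulr0.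
  by rewrite -[RHS](rmorph0 iota) => /iota_inj ->.
(* Both residue maps have the same target [kappa], so every residue class of O' is represented in
   O. *)
have iota_res x : exists a y, x = iota a + y * varpi.
  have [a aE] := rho_res.1 (rho' x); exists a.
  have /varpi_unif[y yE] : x - iota a \isn't a GRing.unit.
    by apply/rho'_res.2; rewrite rmorphB rho'E aE subrr.
  by exists y; rewrite -yE addrC subrK.
(* An integral equation over O holds in K' and descends to O' because [j] is injective. *)
have int x : exists2 p : {poly O}, p != 0 & root (map_poly iota p) x.
  have [j_inj jP] := O'_int.
  have [|p p_monic px] := (jP (j x)).1; first by exists x.
  exists p; first exact: monic_neq0.
  have mapE : map_poly (fun r : O => (tofrac r)%:A) p = map_poly j (map_poly iota p).
    by rewrite -map_poly_comp; apply: eq_map_poly => a; rewrite /= iotaE.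
  apply/rootP/j_inj; rewrite rmorph0 -horner_map -mapE; exact/rootP.
have gen := power_basis_generates O_dvr pi_unif O_complete varpi_unif v_unit piE iota_inj
  iota_res e_gt0 int.
have free := power_basis_free O_dvr pi_unif varpi_unif piE iota_inj e_gt0.
have [coord coordE] := choice gen.
pose b := @FreeBasis _ _ iota e (fun i => varpi ^+ i) coord coordE free.
split.
- exact: (u_ra_universal_homeomorphism u T pi_neq0 varpi_neq0 rho'_varpi v_unit e_gt0 piE (b := b)
    (fun=> erefl)).
- exact: (kernel_pro_infinitesimal u T pi_neq0 varpi_neq0 rho'_varpi v_unit e_gt0 piE (b := b)
    (fun=> erefl)).
- exact: (kernel_iso_ker_ring u T pi_neq0 varpi_neq0 rho'_varpi v_unit e_gt0 piE (b := b)
    (fun=> erefl)).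
Qed.
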